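(* Let $k>0$, $\nu>0$, $\beta>0$, $\alpha^2>0$, let $w_0^h\in X^h$, $\lambda_0^h\in Q^h$, and suppose that for $n=0,1,2,\dots$ the pairs $(w_{n+1}^h,\lambda_{n+1}^h)\in X^h\times Q^h$ satisfy, for all $v^h\in X^h$ and $q^h\in Q^h$, $$\Big(\frac{w_{n+1}^h-w_n^h}{k},v^h\Big)+b^*(w_n^h,w_{n+1}^h,v^h)+\nu(\nabla w_{n+1}^h,\nabla v^h)-(\lambda_{n+1}^h,\nabla\cdot v^h)=(f_{n+1},v^h),$$ $$\Big(\frac{\lambda_{n+1}^h-\lambda_n^h}{k},q^h\Big)+2\beta\Big(\nabla\cdot\Big(\frac{w_{n+1}^h-w_n^h}{k}\Big),q^h\Big)+\alpha^2(\nabla\cdot w_{n+1}^h,q^h)=0.$$ Then the method is unconditionally energy stable: for any $N\ge1$, $$\begin{aligned} &\frac12\|w_N^h\|^2+\frac{\alpha^{-2}}2\|\lambda_N^h+2\beta\Pi_Q(\nabla\cdot w_N^h)\|^2+k\sum_{n=0}^{N-1}\Big(2\beta\|\Pi_Q(\nabla\cdot w_{n+1}^h)\|^2+\nu\|\nabla w_{n+1}^h\|^2\Big)\\ &\quad+\sum_{n=0}^{N-1}\frac12\Big(\alpha^{-2}\|\lambda_{n+1}^h+2\beta\Pi_Q(\nabla\cdot w_{n+1}^h)-\lambda_n^h-2\beta\Pi_Q(\nabla\cdot w_n^h)\|^2+\|w_{n+1}^h-w_n^h\|^2\Big)\\ &=\frac12\|w_0^h\|^2+\frac{\alpha^{-2}}2\|\lambda_0^h+2\beta\Pi_Q(\nabla\cdot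 w_0^h)\|^2+k\sum_{n=0}^{N-1}(f_{n+1},w_{n+1}^h). \end{aligned}$$
   Context: $\Omega\subset\mathbb{R}^d$ ($d=2,3$) is a regular bounded domain; $(\cdot,\cdot)$ and $\|\cdot\|$ are the $L^2(\Omega)$ inner product and norm. $X=(H_0^1(\Omega))^d$ and $Q=L_0^2(\Omega)=\{q\in L^2(\Omega):\int_\Omega q\,dx=0\}$. $X^h\subset X$ and $Q^h\subset Q$ are conforming finite element spaces (depending on a mesh size $h$) satisfying, for a fixed $m$ and constants $C$ independent of $h$, $\inf_{v^h\in X^h}\{\|u-v^h\|+h\|\nabla(u-v^h)\|\}\le Ch^{m+1}|u|_{m+1}$ for $u\in (H^{m+1}(\Omega))^d\cap X$, $\inf_{q^h\in Q^h}\|p-q^h\|\le Ch^m|p|_m$ for $p\in H^m(\Omega)\cap Q$, and the discrete inf-sup condition $\inf_{q^h\in Q^h}\sup_{v^h\in X^h}\frac{(q^h,\nabla\cdot v^h)}{\|q^h\|\|\nabla v^h\|}\ge\gamma^h>0$ with $\gamma^h$ bounded away from zero uniformly in $h$. $\Pi_Q:L_0^2(\Omega)\to Q^h$ is the $L^2$-orthogonal projection: $(r-\Pi_Q(r),q^h)=0$ for all $q^h\in Q^h$. The trilinear form is $b^*(u,v,w)=(u\cdot\nabla v,w)+\frac12((\nabla\cdot u)v,w)$ for $u,v,w\in X$. Here $k$ is the time step, $t_n=nk$, and $f_{n}(x)=f(x,t_{n})$ is the prescribed body force. *)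

(* Defs.v *)
From HB Require Import structures.
From mathcomp Require Import all_boot all_order all_algebra.
From mathcomp Require Import all_classical all_reals all_analysis.

Set Implicit Arguments.
Unset Strict Implicit.
Unset Printing Implicit Defensive.

Import Order.TTheory GRing.Theory Num.Theory.
Import numFieldNormedType.Exports.

Local Open Scope classical_set_scope.
Local Open Scope ring_scope.

Definition rV_display : measure_display -> measure_display.
Proof. exact. Qed.

(* The Borel sigma-algebra of R^n, generated by the coordinate functions. *)
Section measurable_rV.
Context {R : realType} (n : nat).

Let coors : 'I_n -> 'rV[R]_n -> R := fun i x => x 0 i.

Let rV_set0 : g_sigma_preimage coors set0.
Proof. exact: sigma_algebra0. Qed.

Let rV_setC A : g_sigma_preimage coors A -> g_sigma_preimage coors (~` A).
Proof. exact: sigma_algebraC. Qed.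

Let rV_bigcup (F : _^nat) : (forall i, g_sigma_preimage coors (F i)) ->
  g_sigma_preimage coors (\bigcup_i (F i)).
Proof. exact: sigma_algebra_bigcup. Qed.

HB.instance Definition _ :=
  @isMeasurable.Build (rV_display default_measure_display)
    'rV[R]_n (g_sigma_preimage coors) rV_set0 rV_setC rV_bigcup.

End measurable_rV.

Lemma measurable_coord (R : realType) n (i : 'I_n) :
  measurable_fun [set: 'rV[R]_n] (fun x : 'rV[R]_n => x 0 i).
Proof.
move=> _ Y mY; rewrite setTI; apply: sub_sigma_algebra => /=.
rewrite -bigcup_seq/=; exists i => /=; first by rewrite mem_index_enum.
by exists Y => //; rewrite setTI.
Qed.

Lemma measurable_fun_rV d (T : measurableType d) (R : realType) n
    (f : T -> 'rV[R]_n) :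
  (forall i, measurable_fun [set: T] (fun t => f t 0 i)) ->
  measurable_fun [set: T] f.
Proof.
move=> mf.
suff H : @measurable _ 'rV[R]_n `<=`
    image_set_system [set: T] f (@measurable _ T).
  by move=> _ Y mY; exact: H.
apply: smallest_sub.
  by apply: sigma_algebra_image; exact: sigma_algebra_measurable.
rewrite -bigcup_seq => A [i _ [B mB <-]].
rewrite /image_set_system/= !setTI.
by have := mf i measurableT B mB; rewrite !setTI.
Qed.

(* Lebesgue measure on R^n, by recursion on n: the image of the product measure
   on R * R^n under (a, x) |-> a :: x. *)
Definition cons_rV (R : realType) n (p : R * 'rV[R]_n) : 'rV[R]_n.+1 :=
  \row_j (if unlift ord0 j is Some i then p.2 0 i else p.1).

Definition uncons_rV (R : realType) n (x : 'rV[R]_n.+1) : R * 'rV[R]_n :=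
  (x 0 ord0, \row_i x 0 (lift ord0 i)).

Lemma uncons_rVK (R : realType) n : cancel (@uncons_rV R n) (@cons_rV R n).
Proof. by move=> x; apply/rowP => j; rewrite mxE; case: unliftP => [i|] ->; rewrite ?mxE. Qed.

Lemma cons_rVK (R : realType) n : cancel (@cons_rV R n) (@uncons_rV R n).
Proof.
move=> [a x]; rewrite /uncons_rV /cons_rV !mxE unlift_none /=; congr pair.
by apply/rowP => i; rewrite !mxE liftK.
Qed.

Lemma measurable_cons_rV (R : realType) n :
  measurable_fun [set: R * 'rV[R]_n] (@cons_rV R n).
Proof.
apply: measurable_fun_rV => i.
case: (unliftP ord0 i) => [j|] ->.
- rewrite (_ : (fun t => _) = (fun x : 'rV[R]_n => x 0 j) \o snd); last first.
    by apply/funext => t; rewrite mxE liftK.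
  exact: (measurableT_comp (measurable_coord j) measurable_snd).
- rewrite (_ : (fun t => _) = fst); first exact: measurable_fst.
  by apply/funext => t; rewrite mxE unlift_none.
Qed.

Lemma measurable_uncons_rV (R : realType) n :
  measurable_fun [set: 'rV[R]_n.+1] (@uncons_rV R n).
Proof.
apply: measurable_fun_pair; first exact: measurable_coord.
apply: measurable_fun_rV => i.
rewrite (_ : (fun t => _) = (fun x : 'rV[R]_n.+1 => x 0 (lift ord0 i))).
  exact: measurable_coord.
by apply/funext => t; rewrite mxE.
Qed.

Section lebesgue_rVS.
Context {R : realType} (n : nat).
Variable mu : {sigma_finite_measure set 'rV[R]_n -> \bar R}.
Local Open Scope ereal_scope.

Definition lebesgue_rVS : set 'rV[R]_n.+1 -> \bar R :=
  pushforward (@lebesgue_measure R \x mu) (@cons_rV R n).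

Let lebesgue_rVS0 : lebesgue_rVS set0 = 0.
Proof. by rewrite /lebesgue_rVS /pushforward preimage_set0 measure0. Qed.

Let mcons (A : set 'rV[R]_n.+1) : measurable A ->
  measurable (@cons_rV R n @^-1` A).
Proof.
by move=> mA; rewrite -[X in measurable X]setTI; exact: measurable_cons_rV.
Qed.

Let lebesgue_rVS_ge0 A : 0 <= lebesgue_rVS A.
Proof. exact: (measure_ge0 (@lebesgue_measure R \x mu)). Qed.

Let lebesgue_rVS_sigma_additive : semi_sigma_additive lebesgue_rVS.
Proof.
move=> F mF tF mUF; rewrite /lebesgue_rVS /pushforward preimage_bigcup.
apply: measure_semi_sigma_additive.
- by move=> i; exact: mcons.
- apply/trivIsetP => /= i j _ _ ij; rewrite -preimage_setI.
  by move/trivIsetP : tF => /(_ _ _ _ _ ij) ->//; rewrite preimage_set0.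
- by rewrite -preimage_bigcup; exact: mcons.
Qed.

HB.instance Definition _ := isMeasure.Build _ _ _
  lebesgue_rVS lebesgue_rVS0 lebesgue_rVS_ge0 lebesgue_rVS_sigma_additive.

Let lebesgue_rVS_sigma_finite : sigma_finite setT lebesgue_rVS.
Proof.
have /sigma_finiteP[F [UF ndF Foo]] := sigma_finiteT (@lebesgue_measure R).
have /sigma_finiteP[G [UG ndG Goo]] := sigma_finiteT mu.
exists (fun i => @uncons_rV R n @^-1` (F i `*` G i)).
  rewrite -preimage_bigcup (_ : \bigcup_i _ = setT) ?preimage_setT//.
  rewrite -subTset => -[a x] _.
  have [i _ Fia] : (\bigcup_i F i) a by rewrite -UF.
  have [j _ Gjx] : (\bigcup_i G i) x by rewrite -UG.
  exists (maxn i j) => //; split => /=.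
    by move: a Fia; exact/subsetPset/ndF/leq_maxl.
  by move: x Gjx; exact/subsetPset/ndG/leq_maxr.
move=> i; have [mFi Fi] := Foo i; have [mGi Gi] := Goo i; split.
  rewrite -[X in measurable X]setTI; apply: measurable_uncons_rV => //.
  exact: measurableX.
rewrite /lebesgue_rVS /pushforward -comp_preimage.
rewrite (_ : _ \o _ = id) ?preimage_id; last first.
  by apply/funext => x; exact: cons_rVK.
by rewrite product_measure1E// lte_mul_pinfty// ge0_fin_numE.
Qed.

HB.instance Definition _ := @Measure_isSigmaFinite.Build _ _ _
  lebesgue_rVS lebesgue_rVS_sigma_finite.

End lebesgue_rVS.

Fixpoint lebesgue_rV (R : realType) (n : nat) :
    {sigma_finite_measure set 'rV[R]_n -> \bar R} :=
  match n with
  | 0 => \d_(0 : 'rV[R]_0)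
  | m.+1 => lebesgue_rVS (lebesgue_rV R m)
  end.
Arguments lebesgue_rV {R} n.

Definition mxdot (R : realType) p q (A B : 'M[R]_(p, q)) : R :=
  \sum_i \sum_j A i j * B i j.

Section Sobolev.
Context {R : realType} {d : nat}.
Implicit Types (Omega : set 'rV[R]_d) (f g phi : 'rV[R]_d -> R).
Implicit Types u : 'rV[R]_d -> 'rV[R]_d.

(* Omega lies locally on one side of the graph, over the hyperplane orthogonal
   to the unit vector e, of a Lipschitz function phi; y - (y.e) e is the
   orthogonal projection of y onto that hyperplane. *)
Definition lipschitz_boundary Omega := forall x0,
  closure Omega x0 -> ~ Omega x0 ->
  exists (r : R) (e : 'rV[R]_d) (phi : 'rV[R]_d -> R),
    [/\ 0 < r, mxdot e e = 1, lipschitz phi &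
        forall y, ball x0 r y ->
          Omega y <-> phi (y - mxdot y e *: e) < mxdot y e].

Definition regular_bounded_domain Omega :=
  [/\ Omega !=set0, open Omega, connected Omega, bounded_set Omega &
      lipschitz_boundary Omega].

(* Elements of L2 are represented by functions; equality in L2 is equality
   almost everywhere on Omega. *)
Definition L2 Omega f :=
  measurable_fun Omega f /\
  (lebesgue_rV d).-integrable Omega (fun x => (f x ^+ 2)%:E).

Definition ip Omega f g : R := \int[lebesgue_rV d]_(x in Omega) (f x * g x).

Definition nrm Omega f : R := Num.sqrt (ip Omega f f).

Definition mxip Omega p q (A B : 'rV[R]_d -> 'M[R]_(p, q)) : R :=
  \int[lebesgue_rV d]_(x in Omega) mxdot (A x) (B x).

Definition mxnrm Omega p q (A : 'rV[R]_d -> 'M[R]_(p, q)) : R :=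
  Num.sqrt (mxip Omega A A).

Definition component u (i : 'I_d) : 'rV[R]_d -> R := fun x => u x 0 i.

Definition vL2 Omega u := forall i, L2 Omega (component u i).

Definition pderiv (i : 'I_d) phi : 'rV[R]_d -> R :=
  fun x => 'D_(delta_mx 0 i) phi x.

Definition pderivs (s : seq 'I_d) phi : 'rV[R]_d -> R := foldr pderiv phi s.

Definition smooth phi := forall s x, differentiable (pderivs s phi) x.

(* C_c^oo(Omega), extended by zero to the whole space *)
Definition test_function Omega phi :=
  smooth phi /\
  exists2 K, compact K /\ K `<=` Omega & forall x, ~ K x -> phi x = 0.

Definition is_weak_deriv Omega (s : seq 'I_d) f g := forall phi,
  test_function Omega phi ->
  ip Omega f (pderivs s phi) = (-1) ^+ size s * ip Omega g phi.

(* The weak derivative is determined almost everywhere on Omega; wderiv selects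
   a square-integrable representative, when there is one. *)
Definition wderiv Omega (s : seq 'I_d) f : 'rV[R]_d -> R :=
  xget (fun=> 0) [set g | L2 Omega g /\ is_weak_deriv Omega s f g].

Definition Hm Omega (m : nat) f := L2 Omega f /\
  forall s : seq 'I_d, (size s <= m)%N ->
    exists2 g, L2 Omega g & is_weak_deriv Omega s f g.

(* The multi-indices of length m are the sorted words of length m. *)
Definition Hm_seminorm Omega (m : nat) f : R :=
  Num.sqrt (\sum_(s : m.-tuple 'I_d | sorted (fun i j : 'I_d => (i <= j)%N) s)
    nrm Omega (wderiv Omega s f) ^+ 2).

(* The closure of C_c^oo(Omega) in H^1(Omega) *)
Definition H10 Omega f := Hm Omega 1 f /\
  forall eps : R, 0 < eps -> exists2 phi, test_function Omega phi &
    nrm Omega (f - phi) < eps /\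
    forall i, nrm Omega (wderiv Omega [:: i] f - pderiv i phi) < eps.

Definition L20 Omega f :=
  L2 Omega f /\ \int[lebesgue_rV d]_(x in Omega) f x = 0.

Definition H10_vec Omega u := forall i, H10 Omega (component u i).

Definition vHm Omega (m : nat) u := forall i, Hm Omega m (component u i).

Definition vHm_seminorm Omega (m : nat) u : R :=
  Num.sqrt (\sum_i Hm_seminorm Omega m (component u i) ^+ 2).

(* (grad u)_ij = d u_i / d x_j *)
Definition grad Omega u : 'rV[R]_d -> 'M[R]_d :=
  fun x => \matrix_(i, j) wderiv Omega [:: j] (component u i) x.

Definition divergence Omega u : 'rV[R]_d -> R :=
  fun x => \sum_i wderiv Omega [:: i] (component u i) x.

(* u . nabla v *)
Definition advect Omega u (v : 'rV[R]_d -> 'rV[R]_d) : 'rV[R]_d -> 'rV[R]_d :=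
  fun x => \row_i \sum_j u x 0 j * grad Omega v x i j.

Definition bstar Omega u (v w : 'rV[R]_d -> 'rV[R]_d) : R :=
  mxip Omega (advect Omega u v) w
  + 2^-1 * mxip Omega (fun x => divergence Omega u x *: v x) w.

(* A subspace of functions, finite-dimensional modulo equality almost everywhere
   on Omega *)
Definition finite_dim_space Omega (W : lmodType R) (V : set ('rV[R]_d -> W)) :=
  [/\ V 0, forall (a : R) v1 v2, V v1 -> V v2 -> V (a *: v1 + v2) &
      exists (n : nat) (e : 'I_n -> 'rV[R]_d -> W), (forall i, V (e i)) /\
        forall v, V v -> exists c : 'I_n -> R,
          {ae lebesgue_rV d, forall x, Omega x ->
            v x = \sum_i c i *: e i x}].

Definition velocity_approximation Omega (m : nat) (meshes : set R)
    (Xh : R -> set ('rV[R]_d -> 'rV[R]_d)) := exists C : R,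
  forall h, meshes h -> forall u, vHm Omega m.+1 u -> H10_vec Omega u ->
    inf [set mxnrm Omega (u - v) + h * mxnrm Omega (grad Omega (u - v))
        | v in Xh h]
    <= C * h ^+ m.+1 * vHm_seminorm Omega m.+1 u.

Definition pressure_approximation Omega (m : nat) (meshes : set R)
    (Qh : R -> set ('rV[R]_d -> R)) := exists C : R,
  forall h, meshes h -> forall p, Hm Omega m p -> L20 Omega p ->
    inf [set nrm Omega (p - q) | q in Qh h]
    <= C * h ^+ m * Hm_seminorm Omega m p.

Definition inf_sup_constant Omega (Xh : set ('rV[R]_d -> 'rV[R]_d))
    (Qh : set ('rV[R]_d -> R)) : \bar R :=
  ereal_inf [set ereal_sup
      [set (ip Omega q (divergence Omega v)
            / (nrm Omega q * mxnrm Omega (grad Omega v)))%:E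
      | v in [set v | Xh v /\ mxnrm Omega (grad Omega v) != 0]]
    | q in [set q | Qh q /\ nrm Omega q != 0]].

Definition discrete_inf_sup Omega (meshes : set R)
    (Xh : R -> set ('rV[R]_d -> 'rV[R]_d)) (Qh : R -> set ('rV[R]_d -> R)) :=
  exists gamma : R -> R,
    (forall h, meshes h -> 0 < gamma h /\
      ((gamma h)%:E <= inf_sup_constant Omega (Xh h) (Qh h))%E) /\
    exists2 gamma0 : R, 0 < gamma0 & forall h, meshes h -> gamma0 <= gamma h.

Definition conforming_fe_family Omega (m : nat) (meshes : set R)
    (Xh : R -> set ('rV[R]_d -> 'rV[R]_d)) (Qh : R -> set ('rV[R]_d -> R)) :=
  [/\ forall h, meshes h -> [/\ 0 < h,
        Xh h `<=` H10_vec Omega, finite_dim_space Omega (Xh h),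
        Qh h `<=` L20 Omega & finite_dim_space Omega (Qh h)],
      velocity_approximation Omega m meshes Xh,
      pressure_approximation Omega m meshes Qh &
      discrete_inf_sup Omega meshes Xh Qh].

Definition is_L2_projection Omega (Qh : set ('rV[R]_d -> R))
    (P : ('rV[R]_d -> R) -> 'rV[R]_d -> R) := forall r, L20 Omega r ->
  Qh (P r) /\ forall q, Qh q -> ip Omega (r - P r) q = 0.

End Sobolev.

(* Main.v *)
(* The energy identity follows by testing the momentum equation with w_{n+1} and the
   pressure equation with p_{n+1} := lambda_{n+1} + 2 beta Pi_Q (div w_{n+1}), then
   summing the polarization identities.  Three analytic facts make this legitimate.
   - The skew-symmetry b*(u,v,v) = 0 on H^1_0.  It requires u v in L^2, hence the
     embedding of H^1_0 in L^4, obtained from Ladyzhenskaya's inequality for test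
     functions: in dimension 2 from phi^2 <= int |d_i phi^2| along each coordinate
     line, in dimension 3 by applying this to slices.  For a test function psi, the
     identity 2 (u psi, d_i psi) = - (d_i u, psi^2) is the definition of the weak
     derivative of u tested with psi^2; it passes to the limit psi -> v.
   - The weak derivative is linear up to null sets: on H^1_0 the defect is at once an
     L^2 limit of test functions and orthogonal to all of them.
   - div w has zero mean, by Fubini and the fundamental theorem of calculus, so that
     Pi_Q (div w) is governed by the projection property. *)
Require Import Defs.
From mathcomp Require Import all_boot all_order all_algebra.
From mathcomp Require Import all_classical all_reals all_analysis.
From mathcomp Require Import measurable_realfun.
From mathcomp Require Import ring lra.
Set Implicit Arguments.
Unset Strict Implicit.
Unset Printing Implicit Defensive.
Import Order.TTheory GRing.Theory Num.Theory.
Import numFieldNormedType.Exports.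
Local Open Scope classical_set_scope.
Local Open Scope ring_scope.

(** * Borel sets and Lebesgue measure on R^n *)

(** The obstacle is that test functions approach an element of H^1_0 only in the H^1 norm, while the
    cubic form needs control in L^4. Moreover [wderiv] is a chosen representative, so its linearity
    cannot be used before it is proved. Both difficulties are met by [H1_test_limit], the pairs (f,
    g) approximated jointly by (phi, grad phi) in L^2. This class is stable under linear
    combinations by construction, so the L^4 estimate applies to v - psi without any linearity of
    weak derivatives, and the same class later yields that linearity. Limits are taken
    quantitatively: the quantity to be shown zero is bounded by a constant times eps. The
    inequalities for functions on the whole space are stated for nonnegative extended integrals, so
    that Tonelli applies without integrability assumptions. *)

Lemma open_measurable_rV {R : realType} {n : nat} (A : set 'rV[R]_n) :
  open A -> measurable A.
Proof.
move=> oA.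
(* Boxes with rational centre and radius 1/(N+1) are countably many, and each is a finite
   intersection of coordinate preimages; an open set is the union of those it contains. *)
pose box (q : 'rV[rat]_n * nat) : set 'rV[R]_n :=
  [set x | forall i, `|ratr (q.1 0 i) - x 0 i| < q.2.+1%:R^-1].
have mbox q : measurable (box q).
  have -> : box q = \bigcap_(i in [set: 'I_n])
      ((fun x : 'rV[R]_n => x 0 i) @^-1` (ball (ratr (q.1 0 i) : R) q.2.+1%:R^-1)).
    by apply/seteqP; split => [x /= xq i _|x /= xq i]; exact: (xq i).
  apply: fin_bigcap_measurable => [|i _]; first exact: finite_finset.
  rewrite -[X in measurable X]setTI; apply: measurable_coord => //.
  exact: measurable_ball.
have -> : A = \bigcup_(q : 'rV[rat]_n * nat) (if `[< box q `<=` A >] then box q else set0).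
  apply/seteqP; split => [x Ax|x [q _]]; last by case: asboolP => // qA /qA.
  have /nbhs_ballP[e /= e0 xe] : nbhs x A by exact: open_nbhs_nbhs.
  (* Two radii must fit into e: the rational centre is within 1/(N+1) of x, and a point of the box
     within 1/(N+1) of the centre. *)
  have [N /= eN] : exists N : nat, N.+1%:R^-1 + N.+1%:R^-1 < e.
    exists (Num.truncn (2 / e)).
    rewrite -mulr2n -(mulr_natl (_^-1) 2) ltr_pdivrMr ?ltr0Sn// -ltr_pdivrMl//.
    by rewrite mulrC; apply: truncnS_gt.
  have /choice[q xq] : forall i, exists q : rat, `|ratr q - x 0 i| < N.+1%:R^-1.
    move=> i; have [|q] := @rat_in_itvoo R (x 0 i - N.+1%:R^-1) (x 0 i + N.+1%:R^-1).
      by rewrite ltrD2l gtrN// invr_gt0.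
    by rewrite in_itv/= => qi; exists q; rewrite ltr_distl.
  exists (\row_i q i, N) => //=.
  rewrite asboolT => [i /=|y /= yq]; first by rewrite mxE.
  apply: xe; split => // i j; rewrite ord1 /ball/=.
  have := xq j; have := yq j; rewrite mxE => yqj; rewrite distrC => xqj.
  apply: (le_lt_trans (ler_distD (ratr (q j)) _ _)); apply: lt_trans eN.
  exact: ltrD.
apply: countable_bigcupT_measurable => // q.
by case: asboolP => // _; exact: measurable0.
Qed.

Lemma continuous_measurable_rV {R : realType} {n : nat} (f : 'rV[R]_n -> R) :
  continuous f -> measurable_fun [set: 'rV[R]_n] f.
Proof.
move=> /continuousP cf; apply: (measurability _ (RGenOpens.measurableE R)).
move=> _ [_ [a [b ->] <-]]; rewrite setTI; apply: open_measurable_rV.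
exact/cf/interval_open.
Qed.

Lemma ge0_integral_rVS {R : realType} {n : nat} (f : 'rV[R]_n.+1 -> \bar R) :
  measurable_fun [set: 'rV[R]_n.+1] f -> (forall x, 0 <= f x)%E ->
  (\int[lebesgue_rV n.+1]_x f x =
   \int[lebesgue_measure]_t \int[lebesgue_rV n]_x f (cons_rV (t, x)))%E.
Proof.
move=> mf f0.
transitivity (\int[@lebesgue_measure R \x lebesgue_rV n]_p f (cons_rV p))%E.
  have mc : measurable_fun [set: measurableTypeR R * 'rV[R]_n] (@cons_rV R n).
    exact: measurable_cons_rV.
  have H (mu : {measure set (measurableTypeR R * 'rV[R]_n) -> \bar R}) :
      (\int[pushforward mu (@cons_rV R n)]_x f x = \int[mu]_p f (cons_rV p))%E.
    exact: (ge0_integral_pushforward mc).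
  exact: H.
rewrite fubini_tonelli1//.
by apply: measurableT_comp => //; exact: measurable_cons_rV.
Qed.

Lemma measurable_cube {R : realType} (n : nat) (M : R) :
  measurable [set x : 'rV[R]_n | forall i, `|x 0 i| < M].
Proof.
have -> : [set x : 'rV[R]_n | forall i, `|x 0 i| < M] =
   \bigcap_(i in [set: 'I_n]) ((fun x : 'rV[R]_n => x 0 i) @^-1` (ball (0:R) M)).
  apply/seteqP; split => [x /= xq i _|x /= xq i]; first by rewrite /ball/= sub0r normrN.
  by have := xq i Logic.I; rewrite /ball/= sub0r normrN.
apply: fin_bigcap_measurable => [|i _]; first exact: finite_finset.
rewrite -[X in measurable X]setTI; apply: measurable_coord => //.
exact: measurable_ball.
Qed.

Lemma lebesgue_rV_cube_fin {R : realType} (n : nat) (M : R) : 0 < M ->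
  (lebesgue_rV n [set x : 'rV[R]_n | forall i, (`|x 0 i| < M)%R] < +oo)%E.
Proof.
move=> M0; elim: n => [|n IH].
  have -> : [set x : 'rV[R]_0 | forall i, `|x 0 i| < M] = setT.
    by apply/seteqP; split => // x _ [].
  by rewrite [lebesgue_rV 0 _]/= diracT ltry.
have -> : lebesgue_rV n.+1 [set x : 'rV[R]_n.+1 | forall i, `|x 0 i| < M] =
  (@lebesgue_measure R \x lebesgue_rV n)%E
    (ball (0 : R) M `*` [set x : 'rV[R]_n | forall i, `|x 0 i| < M]).
  rewrite /= /lebesgue_rVS /pushforward; congr (product_measure1 _ _ _).
  apply/seteqP; split => -[t x] /=.
    move=> H; split; first by have := H ord0; rewrite mxE unlift_none /ball/= sub0r normrN.
    by move=> i; have := H (lift ord0 i); rewrite mxE liftK.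
  rewrite /ball/= sub0r normrN => -[tM xM] i; rewrite mxE.
  by case: unliftP => [j _|_].
rewrite product_measure1E//=.
- by rewrite lebesgue_measure_ball ?ltW// lte_mul_pinfty// lee_fin mulrn_wge0// ltW.
- exact: measurable_ball.
- exact: measurable_cube.
Qed.

Lemma coord_le_norm {R : realType} {n : nat} (x : 'rV[R]_n) i : `|x 0 i| <= `|x|.
Proof.
by rewrite [leRHS]mx_normrE; exact: (@le_bigmax _ _ _ _ (fun ij => `|x ij.1 ij.2|) (0, i)).
Qed.

Lemma bounded_lebesgue_rV_fin {R : realType} {n : nat} (A : set 'rV[R]_n) :
  measurable A -> bounded_set A -> (lebesgue_rV n A < +oo)%E.
Proof.
move=> mA bA; have [A0|/set0P[a Aa]] := eqVneq A set0.
  by rewrite A0 measure0 ltry.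
have PA : ProperFilter (globally A) by exact: (globally_properfilter Aa).
have [M AM] := (@ex_bound _ _ _ id _ PA).1 bA.
have M0 : 0 < `|M| + 1 by rewrite ltr_wpDl.
apply: le_lt_trans (lebesgue_rV_cube_fin n M0).
apply: le_measure; rewrite ?inE//; last first.
  move=> x Ax i /=; apply: (le_lt_trans (coord_le_norm x i)).
  by apply: (le_lt_trans (AM _ Ax)); rewrite (le_lt_trans (ler_norm _))// ltrDl.
exact: measurable_cube.
Qed.

Section tonelli_rV.
Context {R : realType} {n : nat} (f : 'rV[R]_n.+1 -> \bar R).
Hypotheses (mf : measurable_fun [set: 'rV[R]_n.+1] f) (f0 : forall x, (0 <= f x)%E).

Let mfc : measurable_fun [set: measurableTypeR R * 'rV[R]_n] (f \o @cons_rV R n).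
Proof. by apply: measurableT_comp => //; exact: measurable_cons_rV. Qed.

Lemma ge0_integral_rVS_swap :
  (\int[lebesgue_rV n.+1]_x f x =
   \int[lebesgue_rV n]_x \int[lebesgue_measure]_t f (cons_rV (t, x)))%E.
Proof.
rewrite ge0_integral_rVS//.
exact: (fubini_tonelli (m1 := @lebesgue_measure R) (m2 := lebesgue_rV n) (f \o @cons_rV R n) mfc (fun=> f0 _)).
Qed.

Lemma measurable_fun_integral_rVS :
  measurable_fun [set: R] (fun t => \int[lebesgue_rV n]_x f (cons_rV (t, x)))%E.
Proof.
exact: (measurable_fun_fubini_tonelli_F (m2 := lebesgue_rV n) (f \o @cons_rV R n) mfc (fun=> f0 _)).
Qed.

Lemma measurable_fun_integral_line :
  measurable_fun [set: 'rV[R]_n] (fun x => \int[lebesgue_measure]_t f (cons_rV (t, x)))%E.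
Proof.
exact: (measurable_fun_fubini_tonelli_G (m1 := @lebesgue_measure R) (f \o @cons_rV R n) mfc (fun=> f0 _)).
Qed.

End tonelli_rV.

Lemma ge0_integral_rV1 {R : realType} (f : 'rV[R]_1 -> \bar R) :
  measurable_fun [set: 'rV[R]_1] f -> (forall x, 0 <= f x)%E ->
  (\int[lebesgue_rV 1]_x f x = \int[lebesgue_measure]_t f (@cons_rV R 0 (t, 0%R)))%E.
Proof.
move=> mf f0; rewrite ge0_integral_rVS//; apply: eq_integral => t _.
(* R^0 is a single point of mass 1, so the inner integral is one value of f. *)
have -> : (fun x : 'rV[R]_0 => f (cons_rV (t, x))) = cst (f (@cons_rV R 0 (t, 0))).
  by apply/funext => x /=; congr (f (cons_rV (_, _))); apply/rowP => -[].
by rewrite integral_cst//= diracT mule1.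
Qed.

Lemma measurable_cons_rV_tail {R : realType} {n : nat} (t : R) :
  measurable_fun [set: 'rV[R]_n] (fun x => cons_rV (t, x)).
Proof.
apply: (measurableT_comp (@measurable_cons_rV R n)).
by apply: measurable_fun_pair.
Qed.

(** * The space L^2 *)

Section L2_theory.
Context {R : realType} {d : nat} (Omega : set 'rV[R]_d).
Hypothesis mO : measurable Omega.
Local Notation mu := (lebesgue_rV d).
Implicit Types f g h : 'rV[R]_d -> R.

(** The product is dominated by f^2 + g^2. *)
Lemma L2_integrableM f g : L2 Omega f -> L2 Omega g ->
  mu.-integrable Omega (EFin \o (fun x => f x * g x)).
Proof.
move=> [mf if2] [mg ig2].
apply: (le_integrable mO _ _ (integrableD mO if2 ig2)).
  by apply/measurable_EFinP; exact: measurable_funM.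
move=> x _ /=; rewrite lee_fin normrM [leRHS]ger0_norm ?addr_ge0 ?sqr_ge0//.
rewrite -(real_normK (num_real (f x))) -(real_normK (num_real (g x))).
have := sqr_ge0 (`|f x| - `|g x|); have := normr_ge0 (f x); have := normr_ge0 (g x).
nra.
Qed.

Lemma L2_comb a f g : L2 Omega f -> L2 Omega g -> L2 Omega (a *: f + g).
Proof.
move=> [mf if2] [mg ig2]; split.
  apply: measurable_funD => //.
  exact: (measurable_funM (f := cst a)).
have := integrableD mO (integrableD mO (integrableZl mO (a ^+ 2) if2)
    (integrableZl mO (2 * a) (L2_integrableM (conj mf if2) (conj mg ig2)))) ig2.
apply: eq_integrable => // x _ /=; rewrite -!EFinM -!EFinD; congr EFin.
have -> : (a *: f + g) x = a * f x + g x by [].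
by ring.
Qed.

Lemma L2_0 : L2 Omega 0.
Proof.
split; first exact: measurable_cst.
have := integrable0 mu Omega; apply: eq_integrable => // x _ /=.
by rewrite expr0n.
Qed.

Lemma L2D f g : L2 Omega f -> L2 Omega g -> L2 Omega (f + g).
Proof. by move=> Lf Lg; rewrite -[f]scale1r; exact: L2_comb. Qed.

Lemma L2Z a f : L2 Omega f -> L2 Omega (a *: f).
Proof. by move=> Lf; rewrite -[_ *: _]addr0; apply: L2_comb => //; exact: L2_0. Qed.

Lemma L2B f g : L2 Omega f -> L2 Omega g -> L2 Omega (f - g).
Proof. by move=> Lf Lg; rewrite addrC -scaleN1r; exact: L2_comb. Qed.

Lemma L2_bounded f c : (mu Omega < +oo)%E -> measurable_fun Omega f ->
  (forall x, Omega x -> `|f x| <= c) -> L2 Omega f.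
Proof.
move=> fO mf fc; split => //.
apply: (measurable_bounded_integrable mO fO); first exact: measurable_funX.
exists (c ^+ 2); split; first exact: num_real.
move=> y cy x /= Ox; rewrite normrX; apply: (le_trans _ (ltW cy)).
by rewrite ler_pXn2r ?nnegrE ?(le_trans _ (fc _ Ox)) ?fc.
Qed.

Lemma L2_integrable f : (mu Omega < +oo)%E -> L2 Omega f ->
  mu.-integrable Omega (EFin \o f).
Proof.
move=> fO Lf; have L1 : L2 Omega (cst 1).
  by apply: (@L2_bounded _ 1) => // x _; rewrite normr1.
have := L2_integrableM Lf L1; apply: eq_integrable => // x _ /=.
by rewrite mulr1.
Qed.

Lemma ipC f g : ip Omega f g = ip Omega g f.
Proof. by apply: eq_Rintegral => x _; rewrite mulrC. Qed.

Lemma ip_combl a f g h : L2 Omega f -> L2 Omega g -> L2 Omega h ->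
  ip Omega (a *: f + g) h = a * ip Omega f h + ip Omega g h.
Proof.
move=> Lf Lg Lh; rewrite /ip -RintegralZl//; last exact: L2_integrableM.
rewrite -RintegralD//.
- by apply: eq_Rintegral => x _; rewrite mulrA -mulrDl.
- have := integrableZl mO a (L2_integrableM Lf Lh).
  by apply: eq_integrable => // x _ /=.
- exact: L2_integrableM.
Qed.

Lemma ipDl f g h : L2 Omega f -> L2 Omega g -> L2 Omega h ->
  ip Omega (f + g) h = ip Omega f h + ip Omega g h.
Proof. by move=> Lf Lg Lh; rewrite -[f in LHS]scale1r ip_combl// mul1r. Qed.

Lemma ip0l h : ip Omega 0 h = 0.
Proof.
rewrite /ip (@eq_Rintegral _ _ _ mu Omega (cst 0)); last by move=> x _; rewrite mul0r.
by rewrite Rintegral_cst// mul0r.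
Qed.

Lemma ipZl a f h : L2 Omega f -> L2 Omega h ->
  ip Omega (a *: f) h = a * ip Omega f h.
Proof. by move=> Lf Lh; rewrite -[_ *: _]addr0 ip_combl ?ip0l ?addr0//; exact: L2_0. Qed.

Lemma ipBl f g h : L2 Omega f -> L2 Omega g -> L2 Omega h ->
  ip Omega (f - g) h = ip Omega f h - ip Omega g h.
Proof. by move=> Lf Lg Lh; rewrite addrC -scaleN1r ip_combl// mulN1r addrC. Qed.

Lemma ip_ge0 f : 0 <= ip Omega f f.
Proof. by apply: Rintegral_ge0 => x _; rewrite -expr2 sqr_ge0. Qed.

Lemma sqr_nrm f : nrm Omega f ^+ 2 = ip Omega f f.
Proof. by rewrite sqr_sqrtr// ip_ge0. Qed.

Lemma nrm_ge0 f : 0 <= nrm Omega f.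
Proof. exact: sqrtr_ge0. Qed.

(** The quadratic form (af + bg, af + bg) is nonnegative; at a = -(f,g), b = (f,f) it equals (f,f)
    times the difference of the two sides. *)
Lemma ip_sqr_le f g : L2 Omega f -> L2 Omega g ->
  ip Omega f g ^+ 2 <= ip Omega f f * ip Omega g g.
Proof.
move=> Lf Lg.
have quad a b : 0 <= a ^+ 2 * ip Omega f f + 2 * a * b * ip Omega f g + b ^+ 2 * ip Omega g g.
  have Lag := L2Z b Lg; have Lc : L2 Omega (a *: f + b *: g) by exact: L2_comb.
  have := ip_ge0 (a *: f + b *: g).
  rewrite ip_combl// ipZl//.
  rewrite (ipC f) (ipC g) !ip_combl// !ipZl// (ipC g f).
  by congr (0 <= _); ring.
have [f0|] := eqVneq (ip Omega f f) 0.
  have [->|fg0] := eqVneq (ip Omega f g) 0; first by rewrite f0 mul0r expr0n.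
  (* When (f,f) = 0 the form is affine in a, and this a gives it the value -1. *)
  have := quad (- (ip Omega g g + 1) / (2 * ip Omega f g)) 1.
  rewrite f0 mulr0 add0r expr1n mul1r mulr1.
  suff -> : 2 * (- (ip Omega g g + 1) / (2 * ip Omega f g)) * ip Omega f g = - (ip Omega g g + 1) by lra.
  by field.
move=> f0; have fp : 0 < ip Omega f f by rewrite lt_neqAle eq_sym f0 ip_ge0.
have := quad (- ip Omega f g) (ip Omega f f).
rewrite (_ : _ + _ + _ = ip Omega f f * (ip Omega f f * ip Omega g g - ip Omega f g ^+ 2)); last ring.
by rewrite pmulr_rge0// subr_ge0.
Qed.

Lemma normr_ip_le f g : L2 Omega f -> L2 Omega g ->
  `|ip Omega f g| <= nrm Omega f * nrm Omega g.
Proof.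
move=> Lf Lg; rewrite -(@ler_pXn2r _ 2) ?nnegrE ?mulr_ge0 ?nrm_ge0//.
by rewrite exprMn !sqr_nrm real_normK ?num_real// ip_sqr_le.
Qed.

Lemma nrmD_le f g : L2 Omega f -> L2 Omega g ->
  nrm Omega (f + g) <= nrm Omega f + nrm Omega g.
Proof.
move=> Lf Lg; rewrite -(@ler_pXn2r _ 2) ?nnegrE ?addr_ge0 ?nrm_ge0//.
have Lfg := L2D Lf Lg.
rewrite sqrrD !sqr_nrm ipDl// (ipC f) (ipC g) !ipDl// (ipC g f).
have := normr_ip_le Lf Lg; have := ler_norm (ip Omega f g).
rewrite -mulr_natl; lra.
Qed.

Lemma nrmZ a f : L2 Omega f -> nrm Omega (a *: f) = `|a| * nrm Omega f.
Proof.
move=> Lf; have Laf := L2Z a Lf.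
rewrite /nrm ipZl// ipC ipZl// mulrA -expr2 sqrtrM ?sqr_ge0//.
by rewrite sqrtr_sqr.
Qed.

End L2_theory.

(** * Test functions *)

Section test_functions.
Context {R : realType} {d : nat}.
Implicit Types (f g phi psi : 'rV[R]_d -> R) (Omega : set 'rV[R]_d).

Lemma smooth_differentiable phi x : smooth phi -> differentiable phi x.
Proof. by move=> /(_ [::]). Qed.

Lemma smooth_pderiv i phi : smooth phi -> smooth (pderiv i phi).
Proof.
move=> sphi s x; rewrite /pderivs -[pderiv i phi]/(foldr pderiv phi [:: i]).
by rewrite -foldr_cat; exact: sphi.
Qed.

Lemma pderiv_comb i a f g : (forall x, differentiable f x) ->
  (forall x, differentiable g x) ->
  pderiv i (a *: f + g) = a *: pderiv i f + pderiv i g.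
Proof.
move=> df dg; apply/funext => x; rewrite /pderiv deriveD.
- by rewrite deriveZ//; exact: diff_derivable.
- exact/diff_derivable/differentiableZ.
- exact: diff_derivable.
Qed.

Lemma pderivM i f g : (forall x, differentiable f x) ->
  (forall x, differentiable g x) ->
  pderiv i (f * g) = pderiv i f * g + f * pderiv i g.
Proof.
move=> df dg; apply/funext => x; rewrite /pderiv deriveM; try exact: diff_derivable.
by rewrite addrC [_ *: 'D_ _ f _]mulrC.
Qed.

Lemma smooth_comb a f g : smooth f -> smooth g -> smooth (a *: f + g).
Proof.
move=> sf sg s; have -> : pderivs s (a *: f + g) = a *: pderivs s f + pderivs s g.
  by elim: s => //= i s ->; rewrite pderiv_comb.
by move=> x; apply: differentiableD => //; exact: differentiableZ.
Qed.

Lemma smoothM f g : smooth f -> smooth g -> smooth (f * g).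
Proof.
(* The iterated derivatives of f * g remain finite sums of products of smooth functions. *)
move=> sf sg.
pose sumprod (L : seq (('rV[R]_d -> R) * ('rV[R]_d -> R))) : 'rV[R]_d -> R :=
  foldr (fun p F => p.1 * p.2 + F) 0 L.
pose good L := forall p : ('rV[R]_d -> R) * ('rV[R]_d -> R),
  List.In p L -> smooth p.1 /\ smooth p.2.
have dsum L : good L -> forall x, differentiable (sumprod L) x.
  elim: L => [_ x|p L IH gL x]; first exact: differentiable_cst.
  have [s1 s2] := gL p (or_introl erefl).
  apply: differentiableD; last by apply: IH => q qL; apply: gL; right.
  by apply: differentiableM; exact: smooth_differentiable.
have psum L i : good L -> exists2 L', good L' & pderiv i (sumprod L) = sumprod L'.
  elim: L => [_|p L IH gL].
    by exists [::] => //; apply/funext => x; rewrite /pderiv derive_cst.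
  have gL' : good L by move=> q qL; apply: gL; right.
  have [L' gL'' e] := IH gL'.
  have [s1 s2] := gL p (or_introl erefl).
  exists [:: (pderiv i p.1, p.2), (p.1, pderiv i p.2) & L'].
    by move=> q /= [<-|[<-|/gL'']]//; split => //; exact: smooth_pderiv.
  rewrite /= -e addrA -pderivM; [|by move=> x; exact: smooth_differentiable..].
  rewrite -[p.1 * p.2]scale1r pderiv_comb ?scale1r//; last exact: dsum.
  by move=> x; apply: differentiableM; exact: smooth_differentiable.
move=> s; suff [L gL ->] : exists2 L, good L & pderivs s (f * g) = sumprod L by exact: dsum.
elim: s => [|i s [L gL /= ->]]; last exact: psum.
by exists [:: (f, g)]; [move=> _ [<-|[]]|rewrite /= addr0].
Qed.

(** The same compact set K serves: its complement is open, so off K the function vanishes in a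
    neighbourhood and its derivative is that of a constant. *)
Lemma test_pderiv Omega i phi :
  test_function Omega phi -> test_function Omega (pderiv i phi).
Proof.
move=> [sphi [K [cK KO] phi0]]; split; first exact: smooth_pderiv.
exists K => // x Kx; rewrite /pderiv -(derive_cst (0 : R) x (delta_mx 0 i)).
apply: near_eq_derive.
have : nbhs x (~` K).
  apply: open_nbhs_nbhs; split => //; apply: closed_openC.
  by apply: compact_closed cK; exact: norm_hausdorff.
by apply: filterS => y /phi0.
Qed.

Lemma test_comb Omega a f g : test_function Omega f -> test_function Omega g ->
  test_function Omega (a *: f + g).
Proof.
move=> [sf [K [cK KO] f0]] [sg [L [cL LO] g0]]; split; first exact: smooth_comb.
exists (K `|` L); first by split; [exact: compactU|rewrite subUset].
move=> x /not_orP[/f0 fx /g0 gx].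
have -> : (a *: f + g) x = a * f x + g x by [].
by rewrite fx gx mulr0 addr0.
Qed.

Lemma test0 Omega : test_function Omega (0 : 'rV[R]_d -> R).
Proof.
split.
  move=> s; have -> : pderivs s (0 : 'rV[R]_d -> R) = 0.
    by elim: s => //= i s ->; apply/funext => x; rewrite /pderiv derive_cst.
  by move=> x; exact: differentiable_cst.
by exists set0 => //; split => //; exact: compact0.
Qed.

Lemma testM Omega f g : test_function Omega f -> test_function Omega g ->
  test_function Omega (f * g).
Proof.
move=> [sf [K [cK KO] f0]] [sg _]; split; first exact: smoothM.
by exists K => // x /f0 fx; have -> : (f * g) x = f x * g x by []; rewrite fx mul0r.
Qed.

Lemma test_continuous Omega phi : test_function Omega phi -> continuous phi.
Proof. by move=> [sphi _] x; exact/differentiable_continuous/smooth_differentiable. Qed.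

Lemma test_bounded Omega phi : test_function Omega phi ->
  exists c, forall x, `|phi x| <= c.
Proof.
move=> tphi; have cphi := test_continuous tphi.
move: tphi => [sphi [K [cK KO] phi0]].
have : compact (phi @` K) by apply: continuous_compact => //; exact: continuous_subspaceT.
move=> /compact_bounded[M [_ MK]].
exists (`|M| + 1) => x; have [Kx|/phi0->] := pselect (K x); last by rewrite normr0 addr_ge0.
by apply: (MK (`|M| + 1)); [rewrite (le_lt_trans (ler_norm _))// ltrDl|exists x].
Qed.

Lemma test_measurable Omega phi : test_function Omega phi -> measurable_fun setT phi.
Proof. by move=> /test_continuous; exact: continuous_measurable_rV. Qed.

Lemma test_L2 Omega phi : measurable Omega -> (lebesgue_rV d Omega < +oo)%E ->
  test_function Omega phi -> L2 Omega phi.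
Proof.
move=> mO fO tphi; have [c phic] := test_bounded tphi.
by apply: (@L2_bounded _ _ _ mO _ c) => //; apply: measurable_funTS; exact: test_measurable tphi.
Qed.

End test_functions.

(** * Ladyzhenskaya's inequality *)

(* AM-GM in the double integral, |f(p)g(p)| |f(q)h(q)| = |f(p)h(q)| |g(p)f(q)|, so that
   no finiteness assumption is needed. *)
Lemma mul_integral_normM_le {R : realType} {dd} {T : measurableType dd}
    (mu : {measure set T -> \bar R}) (f g h : T -> R) :
  measurable_fun setT f -> measurable_fun setT g -> measurable_fun setT h ->
  ((\int[mu]_x `|2 * f x * g x|%:E) * (\int[mu]_x `|2 * f x * h x|%:E) <=
   2%:E * (\int[mu]_x (f x ^+ 2)%:E) *
     (\int[mu]_x (g x ^+ 2)%:E + \int[mu]_x (h x ^+ 2)%:E))%E.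
Proof.
move=> mf mg mh.
have mM (u v : T -> R) : measurable_fun setT u -> measurable_fun setT v ->
    measurable_fun setT (fun x : T => `|2 * u x * v x|%:E).
  move=> mu' mv; apply/measurable_EFinP; apply: measurableT_comp => //.
  by apply: measurable_funM => //; apply: measurable_funM.
have m2 (u : T -> R) : measurable_fun setT u -> measurable_fun setT (fun x : T => (u x ^+ 2)%:E).
  by move=> mu'; apply/measurable_EFinP; exact: measurable_funX.
have p2 (u : T -> R) : (forall x : T, setT x -> 0 <= (u x ^+ 2)%:E)%E.
  by move=> x _; rewrite lee_fin sqr_ge0.
have pM (u v : T -> R) : (forall x : T, setT x -> 0 <= `|2 * u x * v x|%:E)%E.
  by move=> x _; rewrite lee_fin.
have c2 (a b : R) : 0 <= 2 * a ^+ 2 * b ^+ 2.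
  by apply: mulr_ge0; [apply: mulr_ge0 => //|]; exact: sqr_ge0.
have k2 (a : R) : (0 <= (2 * a ^+ 2)%:E)%E by rewrite lee_fin mulr_ge0// sqr_ge0.
have i2 (u : T -> R) : (0 <= \int[mu]_x (u x ^+ 2)%:E)%E by apply: integral_ge0; exact: p2.
set F := (\int[mu]_x (f x ^+ 2)%:E)%E; set G := (\int[mu]_x (g x ^+ 2)%:E)%E.
set H := (\int[mu]_x (h x ^+ 2)%:E)%E.
rewrite -ge0_integralZr//; [|exact: mM|exact: integral_ge0].
apply: (@le_trans _ _ (\int[mu]_p ((2 * f p ^+ 2)%:E * H + (2 * g p ^+ 2)%:E * F))%E).
  apply: ge0_le_integral => //.
  - by move=> p _; apply: mule_ge0 => //; exact: integral_ge0.
  - by apply: emeasurable_funM => //; exact: mM.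
  - by apply: emeasurable_funD; apply: emeasurable_funM => //;
      apply/measurable_EFinP; apply: measurable_funM => //; exact: measurable_funX.
  move=> p _; rewrite -ge0_integralZl//; [|exact: mM].
  rewrite /F /H -(ge0_integralZl mu measurableT (m2 h mh) (@p2 h) (k2 (f p))).
  rewrite -(ge0_integralZl mu measurableT (m2 f mf) (@p2 f) (k2 (g p))).
  rewrite -ge0_integralD//; last first.
  - by apply: emeasurable_funM => //; exact: m2.
  - by move=> q _; rewrite -EFinM lee_fin c2.
  - by apply: emeasurable_funM => //; exact: m2.
  - by move=> q _; rewrite -EFinM lee_fin c2.
  apply: ge0_le_integral => //.
  - by apply: emeasurable_funM => //; exact: mM.
  - by apply: emeasurable_funD; apply: emeasurable_funM => //; exact: m2.
  move=> q _; rewrite -!EFinM -EFinD lee_fin -normrM.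
  have -> : 2 * f p * g p * (2 * f q * h q) = 2 * ((f p * h q) * (g p * f q) *+ 2) by ring.
  rewrite normrM ger0_norm// -!mulrA -mulrDr ler_pM2l// ler_norml; apply/andP; split.
    have := sqr_ge0 (f p * h q + g p * f q); rewrite -subr_ge0 => H1.
    by rewrite -subr_ge0; move: H1; congr (0 <= _); ring.
  have := sqr_ge0 (f p * h q - g p * f q) => H1.
  by rewrite -subr_ge0; move: H1; congr (0 <= _); ring.
rewrite ge0_integralD//; last first.
- by apply: emeasurable_funM => //; apply/measurable_EFinP; apply: measurable_funM => //; exact: measurable_funX.
- by move=> p _; apply: mule_ge0; rewrite ?k2 ?i2.
- by apply: emeasurable_funM => //; apply/measurable_EFinP; apply: measurable_funM => //; exact: measurable_funX.
- by move=> p _; apply: mule_ge0; rewrite ?k2 ?i2.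
have mm (u : T -> R) : measurable_fun setT u -> measurable_fun setT (fun x : T => (2 * u x ^+ 2)%:E).
  by move=> mu'; apply/measurable_EFinP; apply: measurable_funM => //; exact: measurable_funX.
rewrite !ge0_integralZr//; try exact: mm; try by move=> p _; rewrite lee_fin mulr_ge0// sqr_ge0.
have e2 (u : T -> R) : measurable_fun setT u ->
    (\int[mu]_x (2 * u x ^+ 2)%:E = 2%:E * \int[mu]_x (u x ^+ 2)%:E)%E.
  by move=> mu'; rewrite -(ge0_integralZl mu measurableT (m2 u mu') (@p2 u)) ?lee_fin.
rewrite !e2// -/F -/G (ge0_muleDr (2%:E * F)%E (i2 g) (i2 h)).
by rewrite addeC -!muleA (muleC G).
- exact: i2.
- exact: i2.
Qed.

(** * Calculus on lines and slices *)

Lemma continuous_is_derive {R : realType} (g dg : R -> R) :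
  (forall s : R, is_derive s (1 : R) g (dg s)) -> continuous g.
Proof.
move=> gdg s; apply: differentiable_continuous; apply/derivable1_diffP.
by have [] := gdg s.
Qed.

Lemma FTC2_is_derive {R : realType} (g dg : R -> R) (a b : R) : a < b ->
  (forall s : R, is_derive s (1 : R) g (dg s)) -> continuous dg ->
  (\int[lebesgue_measure]_(s in `[a, b]) (dg s)%:E = (g b)%:E - (g a)%:E)%E.
Proof.
move=> ab gdg cdg; have cg := continuous_is_derive gdg.
apply: continuous_FTC2 => //.
- exact: continuous_subspaceT.
- split; first by move=> s _; have [] := gdg s.
  + apply: cvg_at_right_filter; exact: cg.
  + apply: cvg_at_left_filter; exact: cg.
- by move=> s _; rewrite derive1E; have [] := gdg s.
Qed.

(** Since g vanishes at -M, g(t) is the integral of its derivative over [-M, t]. *)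
Lemma normr_le_integral_derive {R : realType} (g dg : R -> R) (M t : R) :
  (forall s : R, is_derive s (1 : R) g (dg s)) -> continuous dg ->
  (forall s, M <= `|s| -> g s = 0) ->
  (`|g t|%:E <= \int[lebesgue_measure]_s `|dg s|%:E)%E.
Proof.
move=> gdg cdg g0.
have [Mt|tM] := leP M `|t|; first by rewrite g0// normr0 integral_ge0.
have lt : - M < t by move: tM; rewrite ltr_norml => /andP[].
have M0 : 0 < M by apply: le_lt_trans tM.
have mdg : measurable_fun [set: R] dg by exact: continuous_measurable_fun.
have := FTC2_is_derive lt gdg cdg.
rewrite (g0 (- M)) ?normrN ?ler_norm// sube0 -[`|g t|%:E]/(`|(g t)%:E|)%E => <-.
apply: (@le_trans _ _ (\int[lebesgue_measure]_(s in `[(- M)%R, t]) `|dg s|%:E)%E).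
  apply: le_abse_integral => //.
  by apply/measurable_EFinP; exact: measurable_funTS.
apply: ge0_subset_integral => //.
by apply/measurable_EFinP; exact: measurableT_comp.
Qed.

(** The difference quotients of f o A along u and of f along v are the same function of h. This
    transfers derivatives to lines and slices with no differentiability of A. *)
Lemma derive_line {R : realType} {U V : normedModType R} (A : U -> V) (f : V -> R)
    (a u : U) (v : V) : (forall h : R, A (h *: u + a) = h *: v + A a) ->
  ('D_u (f \o A) a = 'D_v f (A a)) /\ (derivable f (A a) v -> derivable (f \o A) a u).
Proof.
move=> Aline; rewrite /derive /derivable.
rewrite [X in X @ _](_ : _ = (fun h => h^-1 *: ((f \o shift (A a)) (h *: v) - f (A a))))//.
by apply/funext => h /=; rewrite Aline.
Qed.

Lemma cons_rV_lineE {R : realType} {n : nat} (x : 'rV[R]_n) (s h : R) :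
  cons_rV (h *: (1 : R) + s, x) = h *: delta_mx 0 ord0 + cons_rV (s, x).
Proof.
apply/rowP => j; rewrite !mxE eqxx; case: unliftP => [i|] -> /=.
  by rewrite mulr0 add0r.
by [].
Qed.

Lemma cons_rV_shiftE {R : realType} {n : nat} (x : 'rV[R]_n) (s h : R) i :
  cons_rV (s, h *: delta_mx 0 i + x) = h *: delta_mx 0 (lift ord0 i) + cons_rV (s, x).
Proof.
apply/rowP => j; rewrite !mxE eqxx; case: unliftP => [k|] -> /=.
  by rewrite !mxE eqxx (inj_eq lift_inj).
by rewrite mulr0 add0r.
Qed.

Lemma continuous_cons_rV {R : realType} {n : nat} :
  continuous (@cons_rV R n).
Proof.
move=> [s x] /= A [B nB BA].
exists (B 0 ord0, [set y : 'rV[R]_n | forall i, B 0 (lift ord0 i) (y 0 i)]).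
  split => /=.
    by have := nB 0 ord0; rewrite mxE unlift_none.
  exists (fun i j => B 0 (lift ord0 j)); last by move=> y By i; exact: By.
  by move=> i j; rewrite ord1; have := nB 0 (lift ord0 j); rewrite mxE liftK.
move=> [r y] /= [Br By]; apply: BA => i j; rewrite ord1 mxE.
by case: unliftP => [k|] ->.
Qed.

(** The class in which arguments by slicing run. Unlike [test_function] it refers to no domain, and
    the support condition is stated coordinate by coordinate, so both survive freezing the first
    coordinate. *)
Definition C1c {R : realType} {n : nat} (phi : 'rV[R]_n -> R) :=
  [/\ continuous phi, forall i x, derivable phi x (delta_mx 0 i),
      forall i, continuous (pderiv i phi) &
      exists M : R, forall (x : 'rV[R]_n) i, M <= `|x 0 i| -> phi x = 0].

Section slices.
Context {R : realType} {n : nat} (phi : 'rV[R]_n.+1 -> R).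
Hypothesis phi1 : C1c phi.

Lemma pderiv_slice t i x :
  pderiv i (fun y => phi (cons_rV (t, y))) x = pderiv (lift ord0 i) phi (cons_rV (t, x)).
Proof.
exact: (derive_line (A := fun y => cons_rV (t, y)) _ (fun h => cons_rV_shiftE x t h i)).1.
Qed.

Lemma C1c_slice t : C1c (fun x => phi (cons_rV (t, x))).
Proof.
case: phi1 => cphi dphi cdphi [M phi0].
have ct : continuous (fun x : 'rV[R]_n => cons_rV (t, x)).
  move=> x; apply: (@continuous_comp _ _ _ (fun x => (t, x)) (@cons_rV R n)).
    by apply: (@cvg_pair _ _ _ (nbhs x) (nbhs t) (nbhs x)); [exact: cvg_cst|exact: cvg_id].
  exact: continuous_cons_rV.
split.
- by move=> x; apply: continuous_comp; [exact: ct|exact: cphi].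
- move=> i x.
  apply: (derive_line (A := fun y => cons_rV (t, y)) _ (fun h => cons_rV_shiftE x t h i)).2.
  exact: dphi.
- move=> i; rewrite (_ : pderiv i _ = fun x => pderiv (lift ord0 i) phi (cons_rV (t, x))).
    by move=> x; apply: continuous_comp; [exact: ct|exact: cdphi].
  by apply/funext => x; exact: pderiv_slice.
- exists M => x i Mx; apply: (phi0 _ (lift ord0 i)).
  by rewrite mxE liftK.
Qed.

Lemma is_derive_head x (s : R) : is_derive s (1 : R) (fun r => phi (cons_rV (r, x)))
  (pderiv ord0 phi (cons_rV (s, x))).
Proof.
case: phi1 => _ dphi _ _.
have [De Dv] := derive_line (A := fun s => cons_rV (s, x)) phi (fun h => cons_rV_lineE x s h).
by apply: DeriveDef; [apply: Dv; exact: dphi|exact: De].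
Qed.

Lemma continuous_head (f : 'rV[R]_n.+1 -> R) x : continuous f ->
  continuous (fun s : R => f (cons_rV (s, x))).
Proof.
move=> cf s; apply: (@continuous_comp _ _ _ (fun s => cons_rV (s, x))); last exact: cf.
apply: (@continuous_comp _ _ _ (fun s => (s, x)) (@cons_rV R n)).
  by apply: (@cvg_pair _ _ _ (nbhs s) (nbhs s) (nbhs x)); [exact: cvg_id|exact: cvg_cst].
exact: continuous_cons_rV.
Qed.

(** The one-dimensional bound applied to phi^2, whose derivative along the line is 2 phi d_0 phi.
    The right-hand side no longer depends on t. *)
Lemma sqr_le_line_integral t x :
  ((phi (cons_rV (t, x)) ^+ 2)%:E <= \int[lebesgue_measure]_s
     `|2 * phi (cons_rV (s, x)) * pderiv ord0 phi (cons_rV (s, x))|%:E)%E.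
Proof.
case: phi1 => cphi dphi cdphi [M phi0].
pose g (s : R) := phi (cons_rV (s, x)).
have dg s : is_derive s (1 : R) g (pderiv ord0 phi (cons_rV (s, x))) := is_derive_head x s.
have := @normr_le_integral_derive R (fun s => g s ^+ 2)
  (fun s => 2 * phi (cons_rV (s, x)) * pderiv ord0 phi (cons_rV (s, x))) M t.
rewrite ger0_norm ?sqr_ge0//; apply.
- move=> s; rewrite (_ : (fun s => _) = g * g); last by apply/funext => r; rewrite expr2.
  apply: is_derive_eq.
  by rewrite -mulrA mulr_natl mulr2n.
- move=> s; apply: (@continuousM _ _ (fun s => 2 * phi (cons_rV (s, x)))).
    apply: (@continuousM _ _ (fun=> 2)); first exact: cst_continuous.
    exact: continuous_head.
  exact: continuous_head.
- move=> s Ms; rewrite /g (phi0 _ ord0) ?expr0n//.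
  by rewrite mxE unlift_none.
Qed.

End slices.

Section C1c_measurability.
Context {R : realType} {n : nat} (phi : 'rV[R]_n -> R).
Hypothesis phi1 : C1c phi.

Lemma C1c_measurable : measurable_fun setT phi.
Proof. by case: phi1 => cphi *; exact: continuous_measurable_rV. Qed.

Lemma C1c_pderiv_measurable i : measurable_fun setT (pderiv i phi).
Proof. by case: phi1 => _ _ cdphi _; exact: continuous_measurable_rV. Qed.

Lemma C1c_flux_measurable i :
  measurable_fun setT (fun x => `|2 * phi x * pderiv i phi x|%:E).
Proof.
apply/measurable_EFinP; apply: measurableT_comp => //.
by apply: measurable_funM; [apply: measurable_funM => //; exact: C1c_measurable
                           |exact: C1c_pderiv_measurable].
Qed.

End C1c_measurability.

Lemma measurable_EFin_sqr {R : realType} {dd} {T : measurableType dd} (f : T -> R) k :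
  measurable_fun setT f -> measurable_fun setT (fun x => (f x ^+ k)%:E).
Proof. by move=> mf; apply/measurable_EFinP; exact: measurable_funX. Qed.

(** The splitting at the heart of Ladyzhenskaya's argument: for F = phi^4, one factor phi^2 is
    bounded by a function of the head coordinate alone and the other by a function of the tail
    alone, so the integral of the bound factorizes. *)
Lemma integral_rVS_le_mul {R : realType} {n : nat} (F : 'rV[R]_n.+1 -> \bar R)
    (B : R -> \bar R) (A : 'rV[R]_n -> \bar R) :
  measurable_fun setT F -> (forall x, 0 <= F x)%E ->
  measurable_fun setT B -> (forall t, 0 <= B t)%E ->
  measurable_fun setT A -> (forall x, 0 <= A x)%E ->
  (forall t x, F (cons_rV (t, x)) <= B t * A x)%E ->
  (\int[lebesgue_rV n.+1]_x F x <=
   \int[lebesgue_measure]_t B t * \int[lebesgue_rV n]_x A x)%E.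
Proof.
move=> mF F0 mB B0 mA A0 FBA; rewrite ge0_integral_rVS//.
have iA0 : (0 <= \int[lebesgue_rV n]_x A x)%E by apply: integral_ge0.
rewrite -ge0_integralZr//; apply: ge0_le_integral => //.
- by move=> t _; apply: integral_ge0.
- exact: (measurable_fun_integral_rVS mF F0).
- exact: emeasurable_funM.
move=> t _; rewrite -ge0_integralZl//; apply: ge0_le_integral => //.
- exact: (measurableT_comp mF (measurable_cons_rV_tail t)).
- exact: emeasurable_funM.
Qed.

Lemma ladyzhenskaya2 {R : realType} (phi : 'rV[R]_2 -> R) : C1c phi ->
  (\int[lebesgue_rV 2]_x (phi x ^+ 4)%:E <=
   2%:E * (\int[lebesgue_rV 2]_x (phi x ^+ 2)%:E) *
   (\int[lebesgue_rV 2]_x (pderiv (lift ord0 ord0) phi x ^+ 2)%:E +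
    \int[lebesgue_rV 2]_x (pderiv ord0 phi x ^+ 2)%:E))%E.
Proof.
move=> phi1; have mphi := C1c_measurable phi1.
have mH i := C1c_flux_measurable phi1 i.
pose H i x := `|2 * phi x * pderiv i phi x|%:E.
have H0 i x : (0 <= H i x)%E by rewrite lee_fin.
pose A (x : 'rV[R]_1) := (\int[lebesgue_measure]_s H ord0 (cons_rV (s, x)))%E.
pose B (t : R) := (\int[lebesgue_rV 1]_x H (lift ord0 ord0) (cons_rV (t, x)))%E.
have A0 x : (0 <= A x)%E by apply: integral_ge0.
have B0 t : (0 <= B t)%E by apply: integral_ge0.
have mA : measurable_fun setT A by exact: (measurable_fun_integral_line (mH ord0) (H0 ord0)).
have mB : measurable_fun setT B.
  exact: (measurable_fun_integral_rVS (mH (lift ord0 ord0)) (H0 (lift ord0 ord0))).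
have phiA t x : ((phi (cons_rV (t, x)) ^+ 2)%:E <= A x)%E by exact: sqr_le_line_integral.
have phiB t x : ((phi (cons_rV (t, x)) ^+ 2)%:E <= B t)%E.
  have psi1 := C1c_slice phi1 t.
  (* A point of R^1 is a head coordinate with an empty tail, so the line bound for the slice at t is
     an integral over all of R^1. *)
  have -> : x = cons_rV (x 0 0, 0 : 'rV_0).
    by apply/rowP => j; rewrite mxE ord1; case: unliftP => [[]|].
  apply: (le_trans (sqr_le_line_integral psi1 _ _)).
  have mHt : measurable_fun [set: 'rV[R]_1] (fun y => H (lift ord0 ord0) (cons_rV (t, y))).
    exact: (measurableT_comp (mH (lift ord0 ord0)) (measurable_cons_rV_tail t)).
  rewrite /B (ge0_integral_rV1 mHt (fun y => H0 _ _)).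
  rewrite le_eqVlt; apply/orP; left; apply/eqP.
  by apply: eq_integral => s _; rewrite /H pderiv_slice.
have F0 (x : 'rV[R]_2) : (0 <= (phi x ^+ 4)%:E)%E by rewrite lee_fin exprn_even_ge0.
apply: le_trans (integral_rVS_le_mul (measurable_EFin_sqr _ mphi) F0 mB B0 mA A0 _) _.
  move=> t x; rewrite (_ : 4 = 2 + 2)%N// exprD EFinM.
  by apply: lee_pmul (phiB t x) (phiA t x); rewrite lee_fin sqr_ge0.
rewrite /A /B -(ge0_integral_rVS (mH (lift ord0 ord0)) (H0 (lift ord0 ord0))).
rewrite -(ge0_integral_rVS_swap (mH ord0) (H0 ord0)).
exact: (mul_integral_normM_le _ mphi (C1c_pderiv_measurable phi1 _) (C1c_pderiv_measurable phi1 _)).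
Qed.

(** The planar inequality holds on each slice. Its factor S(t), the integral of phi^2 over the
    slice, is bounded uniformly in t by the integral a of |2 phi d_0 phi|, so only the two gradient
    terms remain to be integrated in t. Finally a is split by 2|xy| <= x^2 + y^2. *)
Lemma ladyzhenskaya3 {R : realType} (phi : 'rV[R]_3 -> R) : C1c phi ->
  (\int[lebesgue_rV 3]_x (phi x ^+ 4)%:E <=
   2%:E * (\int[lebesgue_rV 3]_x (phi x ^+ 2)%:E +
           \int[lebesgue_rV 3]_x (pderiv ord0 phi x ^+ 2)%:E) *
   (\int[lebesgue_rV 3]_x (pderiv (lift ord0 (lift ord0 ord0)) phi x ^+ 2)%:E +
    \int[lebesgue_rV 3]_x (pderiv (lift ord0 ord0) phi x ^+ 2)%:E))%E.
Proof.
move=> phi1; have mphi := C1c_measurable phi1.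
pose H x := `|2 * phi x * pderiv ord0 phi x|%:E.
have mH : measurable_fun setT H := C1c_flux_measurable phi1 ord0.
have H0 x : (0 <= H x)%E by rewrite lee_fin.
have msq (f : 'rV[R]_3 -> R) k : measurable_fun setT f ->
    measurable_fun setT (fun x => (f x ^+ k)%:E) by exact: measurable_EFin_sqr.
have sq0 (f : 'rV[R]_3 -> R) x : (0 <= (f x ^+ 2)%:E)%E by rewrite lee_fin sqr_ge0.
have q0 (f : 'rV[R]_3 -> R) x : (0 <= (f x ^+ 4)%:E)%E by rewrite lee_fin exprn_even_ge0.
pose S (t : R) := (\int[lebesgue_rV 2]_x (phi (cons_rV (t, x)) ^+ 2)%:E)%E.
pose G i (t : R) := (\int[lebesgue_rV 2]_x (pderiv (lift ord0 i) phi (cons_rV (t, x)) ^+ 2)%:E)%E.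
have mp i := C1c_pderiv_measurable phi1 i.
have mG i : measurable_fun setT (G i).
  exact: (measurable_fun_integral_rVS (msq _ 2%N (mp (lift ord0 i))) (sq0 _)).
have G0 i t : (0 <= G i t)%E by apply: integral_ge0 => x _; exact: sq0.
have S0 t : (0 <= S t)%E by apply: integral_ge0 => x _; exact: (sq0 phi).
pose a := (\int[lebesgue_rV 3]_x H x)%E.
have a0 : (0 <= a)%E by apply: integral_ge0.
(* Along each line in the first direction phi^2 is at most the line integral; integrating over the
   tail gives a bound free of t. *)
have Sa t : (S t <= a)%E.
  rewrite /a (ge0_integral_rVS_swap mH H0) /S.
  apply: ge0_le_integral.
  - exact: measurableT.
  - by move=> x _; exact: (sq0 phi).
  - exact: (measurableT_comp (msq _ 2%N mphi) (measurable_cons_rV_tail t)).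
  - exact: (measurable_fun_integral_line mH H0).
  - by move=> x _; exact: sqr_le_line_integral.
have leG t i : (\int[lebesgue_rV 2]_x
    (pderiv i (fun y => phi (cons_rV (t, y))) x ^+ 2)%:E <= G i t)%E.
  rewrite le_eqVlt; apply/orP; left; apply/eqP.
  by apply: eq_integral => x _; rewrite pderiv_slice.
have slice t : (\int[lebesgue_rV 2]_x (phi (cons_rV (t, x)) ^+ 4)%:E <=
    2%:E * a * (G (lift ord0 ord0) t + G ord0 t))%E.
  apply: (le_trans (ladyzhenskaya2 (C1c_slice phi1 t))).
  apply: lee_pmul.
  - by apply: mule_ge0; rewrite ?lee_fin//; exact: S0.
  - by apply: adde_ge0; apply: integral_ge0 => x _; rewrite lee_fin sqr_ge0.
  - by apply: lee_pmul => //; [exact: S0|exact: Sa].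
  - exact: (leeD (leG t (lift ord0 ord0)) (leG t ord0)).
apply: (@le_trans _ _ (\int[lebesgue_measure]_t
    (2%:E * a * (G (lift ord0 ord0) t + G ord0 t)))%E).
  rewrite (ge0_integral_rVS (msq _ 4%N mphi) (q0 phi)).
  apply: ge0_le_integral.
  - exact: measurableT.
  - by move=> t _; apply: integral_ge0 => x _; exact: (q0 phi).
  - exact: (measurable_fun_integral_rVS (msq _ 4%N mphi) (q0 _)).
  - by apply: measurable_funeM; apply: emeasurable_funD; exact: mG.
  - by move=> t _; exact: slice.
rewrite ge0_integralZl; first last.
- by apply: mule_ge0; rewrite ?lee_fin.
- by move=> t _; apply: adde_ge0; exact: G0.
- by apply: emeasurable_funD; exact: mG.
- exact: measurableT.
rewrite ge0_integralD; first last.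
- exact: mG.
- by move=> t _; exact: G0.
- exact: mG.
- by move=> t _; exact: G0.
- exact: measurableT.
have leI i : (\int[lebesgue_measure]_t G i t <=
    \int[lebesgue_rV 3]_x (pderiv (lift ord0 i) phi x ^+ 2)%:E)%E.
  rewrite le_eqVlt; apply/orP; left; apply/eqP.
  exact: (esym (ge0_integral_rVS (msq _ 2%N (mp (lift ord0 i))) (sq0 _))).
apply: lee_pmul.
- by apply: mule_ge0; rewrite ?lee_fin.
- by apply: adde_ge0; apply: integral_ge0 => t _; exact: G0.
- apply: lee_pmul; rewrite ?lee_fin//.
  rewrite -ge0_integralD; first last.
  + exact: (msq _ 2%N (mp _)).
  + by move=> x _; exact: (sq0 (pderiv _ phi)).
  + exact: (msq _ 2%N mphi).
  + by move=> x _; exact: (sq0 phi).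
  + exact: measurableT.
  apply: ge0_le_integral.
  + exact: measurableT.
  + by move=> x _; exact: H0.
  + exact: mH.
  + by apply: emeasurable_funD; [exact: (msq _ 2%N mphi)|exact: (msq _ 2%N (mp _))].
  move=> x _; rewrite /H -EFinD lee_fin ler_norml; apply/andP; split.
    have := sqr_ge0 (phi x + pderiv ord0 phi x); lra.
  have := sqr_ge0 (phi x - pderiv ord0 phi x); lra.
- exact: (leeD (leI (lift ord0 ord0)) (leI ord0)).
Qed.

(** * Integrals of test functions *)

(** The vanishing of the integral is expressed as equality of the positive and negative parts,
    because Tonelli can be applied to each part separately in higher dimension. *)
Lemma integral_derive_eq0 {R : realType} (g dg : R -> R) (M : R) :
  (forall s : R, is_derive s (1 : R) g (dg s)) -> continuous dg ->
  (forall s, M <= `|s| -> g s = 0) ->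
  (\int[lebesgue_measure]_s (EFin \o dg)^\+ s = \int[lebesgue_measure]_s (EFin \o dg)^\- s)%E.
Proof.
move=> gdg cdg g0.
(* M may be negative or zero; this N gives a nondegenerate interval at whose ends g vanishes and
   outside which g vanishes locally, hence so does its derivative. *)
pose N := `|M| + 1; have N0 : 0 < N by rewrite ltr_wpDl.
have MN : M < N by rewrite (le_lt_trans (ler_norm _))// ltrDl.
have NN : - N < N by rewrite gtrN.
have dg0 s : ~ `[- N, N]%classic s -> dg s = 0.
  move=> sN; have Ms : M < `|s|.
    rewrite ltNge; apply/negP => sM; apply: sN.
    by rewrite /= in_itv/= -ler_norml (le_trans sM)// ltW.
  have [_ <-] := gdg s; rewrite -(derive_cst (0 : R) s (1 : R)).
  apply: near_eq_derive; near=> r => /=; apply: g0; apply: ltW; near: r.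
  exact: (cvgr_gt _ (@norm_continuous _ R s) _ Ms).
pose D : set R := `[- N, N]%classic.
have ext (h : R -> \bar R) : (forall s, ~ D s -> h s = 0%E) ->
    (\int[lebesgue_measure]_s h s = \int[lebesgue_measure]_(s in D) h s)%E.
  move=> h0; rewrite [RHS]integral_mkcond; apply: eq_integral => s _.
  by rewrite patchE; case: ifPn => //; rewrite notin_setE => /h0.
rewrite !ext; last 2 first.
- by move=> s /dg0 e; rewrite funenegE /= e ?oppe0 ?oppr0 maxxx.
- by move=> s /dg0 e; rewrite funeposE /= e maxxx.
have idg : lebesgue_measure.-integrable D (EFin \o dg).
  apply: continuous_compact_integrable; first exact: segment_compact.
  exact: continuous_subspaceT.
have : (\int[lebesgue_measure]_(s in D) (EFin \o dg) s = 0)%E.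
  rewrite (FTC2_is_derive NN gdg cdg).
  by rewrite (g0 N) ?(g0 (- N)) ?normrN ?(gtr0_norm N0) ?(ltW MN)// sube0.
have mD : measurable (D : set (measurableTypeR R)) by exact: measurable_itv.
have fp := integrable_pos_fin_num mD idg; have fn := integrable_neg_fin_num mD idg.
rewrite integralE => /eqP; rewrite sube_eq ?fin_num_adde_defl//.
by rewrite add0e => /eqP.
Unshelve. all: by end_near. Qed.

(** For the first axis the order of integration is exchanged so that the head variable is innermost
    and the line result applies; for any other axis the induction hypothesis applies on each
    slice. *)
Lemma integral_pderiv_eq0 {R : realType} {n : nat} (phi : 'rV[R]_n -> R) i : C1c phi ->
  (\int[lebesgue_rV n]_x (EFin \o pderiv i phi)^\+ x =
   \int[lebesgue_rV n]_x (EFin \o pderiv i phi)^\- x)%E.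
Proof.
elim: n => [|n IH] in phi i *; first by case: i.
move=> phi1; have [_ _ cdphi [M phi0]] := phi1.
have mp i' : measurable_fun setT (EFin \o pderiv i' phi).
  by apply/measurable_EFinP; exact: C1c_pderiv_measurable.
have mpos i' := measurable_funepos (mp i').
have mneg i' := measurable_funeneg (mp i').
have p0 i' x := funepos_ge0 (EFin \o pderiv i' phi) x.
have n0 i' x := funeneg_ge0 (EFin \o pderiv i' phi) x.
case: (unliftP ord0 i) => [j|] ->.
  rewrite (ge0_integral_rVS (mpos _) (p0 _)) (ge0_integral_rVS (mneg _) (n0 _)).
  apply: eq_integral => t _.
  have e : pderiv j (fun y => phi (cons_rV (t, y))) =
      fun x => pderiv (lift ord0 j) phi (cons_rV (t, x)).
    by apply/funext => x; rewrite pderiv_slice.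
  have := IH _ j (C1c_slice phi1 t); rewrite e => eq.
  transitivity (\int[lebesgue_rV n]_x
      (EFin \o (fun x => pderiv (lift ord0 j) phi (cons_rV (t, x))))^\+ x)%E.
    by apply: eq_integral => x _; rewrite !funeposE.
  by rewrite eq; apply: eq_integral => x _; rewrite !funenegE.
rewrite (ge0_integral_rVS_swap (mpos _) (p0 _)) (ge0_integral_rVS_swap (mneg _) (n0 _)).
apply: eq_integral => x _.
have eq := integral_derive_eq0 (is_derive_head phi1 x) (continuous_head (x := x) (cdphi ord0)) (M := M).
transitivity (\int[lebesgue_measure]_s
    (EFin \o (fun s => pderiv ord0 phi (cons_rV (s, x))))^\+ s)%E.
  by apply: eq_integral => s _; rewrite !funeposE.
rewrite eq; first by apply: eq_integral => s _; rewrite !funenegE.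
by move=> s Ms; apply: (phi0 _ ord0); rewrite mxE unlift_none.
Qed.

Section test_function_integrals.
Context {R : realType} {d : nat} (Omega : set 'rV[R]_d).
Hypotheses (mO : measurable Omega) (fO : (lebesgue_rV d Omega < +oo)%E).
Local Notation mu := (lebesgue_rV d).

Lemma test_C1c phi : test_function Omega phi -> C1c phi.
Proof.
move=> tphi; split.
- exact: test_continuous tphi.
- by move=> i x; apply: diff_derivable; apply: smooth_differentiable; case: tphi.
- by move=> i; exact: test_continuous (test_pderiv i tphi).
- case: tphi => _ [K [/compact_bounded[M [_ MK]] _] phi0].
  exists (`|M| + 2) => x i Mx; apply: phi0 => Kx.
  have := MK (`|M| + 1); rewrite (le_lt_trans (ler_norm _)) ?ltrDl// => /(_ isT _ Kx).
  move=> /= xM; have := le_trans (coord_le_norm x i) xM.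
  by move=> /(le_trans Mx); rewrite lerD2l; lra.
Qed.

(** Moves between Omega and the whole space, where slicing is possible. *)
Lemma integral_test_supp phi (h : 'rV[R]_d -> \bar R) : test_function Omega phi ->
  (forall x, phi x = 0 -> h x = 0%E) ->
  (\int[mu]_x h x = \int[mu]_(x in Omega) h x)%E.
Proof.
move=> [_ [K [_ KO] phi0]] h0; rewrite [RHS]integral_mkcond; apply: eq_integral => x _.
rewrite patchE; case: ifPn => //; rewrite notin_setE => Ox.
by apply: h0; apply: phi0 => /KO.
Qed.

Lemma Rintegral_pderiv_test i phi : test_function Omega phi ->
  \int[mu]_(x in Omega) pderiv i phi x = 0.
Proof.
move=> tphi; rewrite /Rintegral integralE.
have tp := test_pderiv i tphi.
rewrite -(integral_test_supp tp); last by move=> x e; rewrite funeposE e maxxx.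
rewrite -(integral_test_supp tp); last by move=> x e; rewrite funenegE e ?oppe0 ?oppr0 maxxx.
rewrite (integral_pderiv_eq0 i (test_C1c tphi)).
(* Equal parts cancel even if infinite, since [fine] is 0 at infinite values. *)
set a := (\int[_]_(_ in _) _)%E.
by case: a => //= r; rewrite subrr.
Qed.

Lemma test_sqr_integral phi : test_function Omega phi ->
  (\int[mu]_x (phi x ^+ 2)%:E = (ip Omega phi phi)%:E)%E.
Proof.
move=> tphi; rewrite (integral_test_supp tphi); last by move=> x ->; rewrite expr0n.
have Lphi := test_L2 mO fO tphi.
rewrite /ip /Rintegral fineK; first by apply: eq_integral => x _; rewrite expr2.
exact: integrable_fin_num (L2_integrableM mO Lphi Lphi).
Qed.

(** The squared H^1 norm of f, with its gradient g supplied separately. *)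
Definition h1_energy (f : 'rV[R]_d -> R) (g : 'I_d -> 'rV[R]_d -> R) :=
  ip Omega f f + \sum_i ip Omega (g i) (g i).

End test_function_integrals.

(** One bound for both dimensions: each of the two factors on the right of the planar and of the
    spatial inequality is at most the energy. *)
Lemma test_ladyzhenskaya {R : realType} {d : nat} (Omega : set 'rV[R]_d) phi :
  d = 2%N \/ d = 3%N -> measurable Omega -> (lebesgue_rV d Omega < +oo)%E ->
  test_function Omega phi ->
  ip Omega (phi * phi) (phi * phi) <=
    2 * h1_energy Omega phi (fun i => pderiv i phi) ^+ 2.
Proof.
move=> d23 mO fO tphi; have phi1 := test_C1c tphi.
have tp i : test_function Omega (pderiv i phi) := test_pderiv i tphi.
rewrite -lee_fin -(test_sqr_integral mO fO (testM tphi tphi)).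
have e4 : (\int[lebesgue_rV d]_x ((phi * phi) x ^+ 2)%:E =
    \int[lebesgue_rV d]_x (phi x ^+ 4)%:E)%E.
  apply: eq_integral => x _; have -> : (phi * phi) x = phi x * phi x by [].
  by congr EFin; ring.
rewrite e4 {e4} /h1_energy.
have [b bE] : exists b, forall i, ip Omega (pderiv i phi) (pderiv i phi) = b i.
  by exists (fun i => ip Omega (pderiv i phi) (pderiv i phi)).
have b0 i : 0 <= b i by rewrite -bE ip_ge0.
have gi i : (\int[lebesgue_rV d]_x (pderiv i phi x ^+ 2)%:E = (b i)%:E)%E.
  by rewrite (test_sqr_integral mO fO (tp i)) bE.
rewrite (eq_bigr b) {bE}//.
have a0 := ip_ge0 Omega phi.
have g := test_sqr_integral mO fO tphi.
move: (ip Omega phi phi) a0 g => a a0 g.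
case: d23 => ed; subst d.
  have := ladyzhenskaya2 phi1.
  rewrite g (gi ord0) (gi (lift ord0 ord0)) big_ord_recl big_ord1 => H.
  apply: (le_trans H); rewrite -EFinD -!EFinM lee_fin.
  have := b0 ord0; have := b0 (lift ord0 ord0).
  move: (b ord0) (b (lift ord0 ord0)) => x y; nra.
have := ladyzhenskaya3 phi1.
rewrite g (gi ord0) (gi (lift ord0 ord0)) (gi (lift ord0 (lift ord0 ord0))).
rewrite big_ord_recl big_ord_recl big_ord1 => H.
apply: (le_trans H); rewrite -!EFinD -!EFinM lee_fin.
have := b0 ord0; have := b0 (lift ord0 ord0); have := b0 (lift ord0 (lift ord0 ord0)).
move: (b ord0) (b (lift ord0 ord0)) (b (lift ord0 (lift ord0 ord0))) => x y z; nra.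
Qed.

(** * The embedding of H^1_0 in L^4 *)

Definition H1_test_limit {R : realType} {d : nat} (Omega : set 'rV[R]_d)
    (f : 'rV[R]_d -> R) (g : 'I_d -> 'rV[R]_d -> R) :=
  [/\ L2 Omega f, forall i, L2 Omega (g i) & forall eps : R, 0 < eps ->
    exists phi, [/\ test_function Omega phi, nrm Omega (f - phi) < eps &
      forall i, nrm Omega (g i - pderiv i phi) < eps]].

Section H1_test_limit_theory.
Context {R : realType} {d : nat} (Omega : set 'rV[R]_d).
Hypotheses (d23 : d = 2%N \/ d = 3%N) (mO : measurable Omega)
  (fO : (lebesgue_rV d Omega < +oo)%E).
Local Notation mu := (lebesgue_rV d).
Implicit Types f phi : 'rV[R]_d -> R.

Lemma nrm0 : nrm Omega 0 = 0.
Proof. by rewrite /nrm (ip0l mO) sqrtr0. Qed.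

Lemma H1_test_limit_test phi : test_function Omega phi ->
  H1_test_limit Omega phi (fun i => pderiv i phi).
Proof.
move=> tphi; split; [exact: test_L2|by move=> i; apply: test_L2 => //; exact: test_pderiv|].
move=> eps e0; exists phi; split => // [|i]; first by rewrite subrr nrm0.
by rewrite subrr nrm0.
Qed.

Lemma nrm_comb_lt a f1 f2 phi1 phi2 eps : 0 < eps ->
  L2 Omega f1 -> L2 Omega f2 -> L2 Omega phi1 -> L2 Omega phi2 ->
  nrm Omega (f1 - phi1) < eps / (`|a| + 1) -> nrm Omega (f2 - phi2) < eps / (`|a| + 1) ->
  nrm Omega (a *: f1 + f2 - (a *: phi1 + phi2)) < eps.
Proof.
move=> e0 L1 L2' M1 M2 n1 n2.
have -> : a *: f1 + f2 - (a *: phi1 + phi2) = a *: (f1 - phi1) + (f2 - phi2).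
  by rewrite scalerBr opprD addrACA.
have B1 := L2B mO L1 M1; have B2 := L2B mO L2' M2.
apply: (le_lt_trans (nrmD_le mO (L2Z mO a B1) B2)).
rewrite nrmZ//.
have a1 : 0 < `|a| + 1 by rewrite ltr_wpDl.
have -> : eps = `|a| * (eps / (`|a| + 1)) + eps / (`|a| + 1) by field; rewrite gt_eqF.
by apply: ler_ltD => //; apply: ler_wpM2l => //; exact: ltW.
Qed.

Lemma H1_test_limit_comb a f1 f2 g1 g2 :
  H1_test_limit Omega f1 g1 -> H1_test_limit Omega f2 g2 ->
  H1_test_limit Omega (a *: f1 + f2) (fun i => a *: g1 i + g2 i).
Proof.
move=> [Lf1 Lg1 H1] [Lf2 Lg2 H2]; split; [exact: L2_comb|by move=> i; exact: L2_comb|].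
move=> eps e0; have e1 : 0 < eps / (`|a| + 1) by rewrite divr_gt0// ltr_wpDl.
have [phi1 [t1 n1 m1]] := H1 _ e1; have [phi2 [t2 n2 m2]] := H2 _ e1.
have Lt phi : test_function Omega phi -> L2 Omega phi by exact: test_L2.
exists (a *: phi1 + phi2); split; first exact: test_comb.
  by apply: nrm_comb_lt => //; exact: Lt.
move=> i; rewrite pderiv_comb.
- by apply: nrm_comb_lt => //; apply: Lt; exact: test_pderiv.
- by move=> x; apply: smooth_differentiable; case: t1.
- by move=> x; apply: smooth_differentiable; case: t2.
Qed.

Lemma nrm_triangle_le f phi c e : L2 Omega f -> L2 Omega phi ->
  nrm Omega f <= c -> nrm Omega (f - phi) <= e -> nrm Omega phi <= c + e.
Proof.
move=> Lf Lp fc fe.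
have -> : phi = f + (-1) *: (f - phi) by rewrite scaleN1r opprB addrC subrK.
have LB := L2B mO Lf Lp; apply: (le_trans (nrmD_le mO Lf (L2Z mO _ LB))).
by rewrite nrmZ// normrN1 mul1r lerD.
Qed.

Lemma ip_le_sqr f c : nrm Omega f <= c -> ip Omega f f <= c ^+ 2.
Proof. by move=> fc; rewrite -sqr_nrm ler_pXn2r ?nnegrE ?nrm_ge0// (le_trans _ fc)// nrm_ge0. Qed.

(** The approximating phi and its derivatives have norm at most 2, so its energy is at most 4 + 4d.
    The factor 16 is 8 from [min4_le] times 2 from Ladyzhenskaya; the last 8 bounds the term 8 M^2
    ||f - phi||^2. *)
Definition L4_const : R := 16 * (4 + 4 * d%:R) ^+ 2 + 8.

(** Truncation at height M lets a fourth power be controlled by an L^2 distance: with r = min(|a -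
    b|, M) the left side is at most (|b| + r)^4 <= 8 b^4 + 8 r^4, and r^4 <= M^2 (a - b)^2. *)
Lemma min4_le (a b M : R) : 0 < M ->
  Num.min `|a| M ^+ 4 <= 8 * (b * b) ^+ 2 + 8 * M ^+ 2 * (a - b) ^+ 2.
Proof.
move=> M0; set m := Num.min _ _; pose r := Num.min `|a - b| M.
have r0 : 0 <= r by rewrite le_min normr_ge0 ltW.
have m0 : 0 <= m by rewrite le_min normr_ge0 ltW.
have mr : m <= `|b| + r.
  rewrite /r; case: (leP `|a - b| M) => H.
    by rewrite ge_min -{1}(subrK b a) addrC ler_normD.
  by rewrite ge_min; apply/orP; right; rewrite lerDr.
have r4 : r ^+ 4 <= M ^+ 2 * (a - b) ^+ 2.
  rewrite (_ : 4 = 2 + 2)%N// exprD -(real_normK (num_real (a - b))).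
  have rM : r <= M by rewrite /r ge_min lexx orbT.
  have rab : r <= `|a - b| by rewrite /r ge_min lexx.
  by apply: ler_pM; rewrite ?exprn_ge0// lerXn2r ?nnegrE// ltW.
have : m ^+ 4 <= (`|b| + r) ^+ 4 by rewrite ler_pXn2r ?nnegrE// addr_ge0.
move=> /le_trans; apply.
have -> : (b * b) ^+ 2 = `|b| ^+ 4 by rewrite -normrX ger0_norm ?exprn_even_ge0//; ring.
move: (normr_ge0 b); move: `|b| => c c0; clearbody r.
have : (c + r) ^+ 4 <= 8 * c ^+ 4 + 8 * r ^+ 4.
  have h : (c + r) ^+ 2 <= 2 * (c ^+ 2 + r ^+ 2) by have := sqr_ge0 (c - r); lra.
  have h2 : ((c + r) ^+ 2) ^+ 2 <= (2 * (c ^+ 2 + r ^+ 2)) ^+ 2.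
    by rewrite ler_pXn2r ?nnegrE ?mulr_ge0 ?addr_ge0 ?sqr_ge0.
  have := sqr_ge0 (c ^+ 2 - r ^+ 2).
  rewrite (_ : (c + r) ^+ 4 = ((c + r) ^+ 2) ^+ 2); [lra|by ring].
lra.
Qed.

(** A test function within 1/M of f makes M^2 ||f - phi||^2 at most 1, so the bound does not depend
    on M. *)
Lemma truncated_L4_le f g (M : R) : 1 <= M -> H1_test_limit Omega f g ->
  nrm Omega f <= 1 -> (forall i, nrm Omega (g i) <= 1) ->
  (\int[mu]_(x in Omega) (Num.min `|f x| M ^+ 4)%:E <= L4_const%:E)%E.
Proof.
move=> M1 [Lf Lg Hf] f1 g1; have M0 : 0 < M by apply: lt_le_trans M1.
have Mi0 : 0 < M^-1 by rewrite invr_gt0.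
have [phi [tphi nphi dphi]] := Hf M^-1 Mi0.
have Lp : L2 Omega phi by exact: test_L2.
have Lpp : L2 Omega (phi * phi) by apply: test_L2 => //; exact: testM.
have Lr := L2B mO Lf Lp.
have i1 := L2_integrableM mO Lpp Lpp; have i2 := L2_integrableM mO Lr Lr.
have mf : measurable_fun Omega f by case: Lf.
pose F1 x := (phi * phi) x * (phi * phi) x; pose F2 x := (f - phi) x * (f - phi) x.
have i3 : mu.-integrable Omega (fun x => 8%:E * (EFin \o F1) x
   + (8 * M ^+ 2)%:E * (EFin \o F2) x)%E.
  by apply: integrableD => //; apply: integrableZl.
apply: (@le_trans _ _ (\int[mu]_(x in Omega)
   (8%:E * (EFin \o F1) x + (8 * M ^+ 2)%:E * (EFin \o F2) x)))%E.
  apply: ge0_le_integral => //.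
  - by move=> x _; rewrite lee_fin exprn_ge0// le_min normr_ge0 ltW.
  - apply/measurable_EFinP; apply: measurable_funX; apply: measurable_minr => //.
    exact: measurableT_comp.
  - exact: measurable_int i3.
  - move=> x _ /=; rewrite -!EFinM -EFinD lee_fin /F1 /F2 -!expr2.
    exact: (min4_le (f x) (phi x) M0).
rewrite integralD//; [|exact: integrableZl..].
rewrite !integralZl//.
have fE (h : 'rV[R]_d -> R) : mu.-integrable Omega (EFin \o h) ->
    (\int[mu]_(x in Omega) (EFin \o h) x = (\int[mu]_(x in Omega) h x)%:E)%E.
  by move=> ih; rewrite /Rintegral fineK//; exact: integrable_fin_num.
rewrite !fE// -!EFinM -EFinD lee_fin.
rewrite -/(ip Omega (phi * phi) (phi * phi)) -/(ip Omega (f - phi) (f - phi)).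
have Mi1 : M^-1 <= 1 by rewrite invf_le1.
have h1 : h1_energy Omega phi (fun i => pderiv i phi) <= 4 + 4 * d%:R.
  apply: lerD.
    have -> : (4 : R) = (1 + 1) ^+ 2 by ring.
    apply: ip_le_sqr; apply: (nrm_triangle_le Lf) => //.
    by apply: le_trans Mi1; exact: ltW.
  apply: (@le_trans _ _ (\sum_(i < d) (1 + 1) ^+ 2)).
    apply: ler_sum => i _; apply: ip_le_sqr; apply: (nrm_triangle_le (Lg i)) => //.
      by apply: test_L2 => //; exact: test_pderiv.
    by apply: le_trans Mi1; exact: ltW.
  by rewrite sumr_const card_ord -mulr_natr; lra.
have h0 : 0 <= h1_energy Omega phi (fun i => pderiv i phi).
  by apply: addr_ge0; [exact: ip_ge0|apply: sumr_ge0 => i _; exact: ip_ge0].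
have h2 : h1_energy Omega phi (fun i => pderiv i phi) ^+ 2 <= (4 + 4 * d%:R) ^+ 2.
  by rewrite ler_pXn2r ?nnegrE// (le_trans h0).
have lady := test_ladyzhenskaya d23 mO fO tphi.
have r2 : 8 * M ^+ 2 * ip Omega (f - phi) (f - phi) <= 8.
  rewrite -mulrA ler_piMr//.
  rewrite -(@divff _ (M ^+ 2)) ?expf_neq0 ?gt_eqF// ler_pM2l ?exprn_gt0//.
  by rewrite -exprVn; apply: ip_le_sqr; exact: ltW.
rewrite /L4_const; lra.
Qed.

Lemma L4_le_const f g : H1_test_limit Omega f g ->
  nrm Omega f <= 1 -> (forall i, nrm Omega (g i) <= 1) ->
  L2 Omega (f * f) /\ ip Omega (f * f) (f * f) <= L4_const.
Proof.
move=> Hfg f1 g1; have [[mf _] _ _] := Hfg.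
pose m n x : \bar R := (Num.min `|f x| n.+1%:R ^+ 4)%:E.
have min0 n x : 0 <= Num.min `|f x| n.+1%:R by rewrite le_min normr_ge0 ler0n.
have mm n : measurable_fun Omega (m n).
  apply/measurable_EFinP; apply: measurable_funX; apply: measurable_minr => //.
  exact: measurableT_comp.
have m0 n x : Omega x -> (0 <= m n x)%E by move=> _; rewrite lee_fin exprn_ge0.
have ndm x : Omega x -> nondecreasing_seq (m ^~ x).
  move=> _ n p np; rewrite lee_fin lerXn2r ?nnegrE//.
  by rewrite le_min ge_min lexx/= ge_min ler_nat ltnS np orbT.
(* At a fixed point the truncation is inactive once its height exceeds |f x|; monotone convergence
   then removes it from the integral. *)
have limm x : limn (m ^~ x) = (f x ^+ 4)%:E.
  apply/cvg_lim => //; apply: cvg_near_cst.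
  exists (Num.truncn `|f x|) => // n /= fn; rewrite /m min_l.
    by rewrite -normrX ger0_norm// exprn_even_ge0.
  by apply: ltW; apply: (lt_le_trans (truncnS_gt _)); rewrite ler_nat ltnS.
have bound : (\int[mu]_(x in Omega) (f x ^+ 4)%:E <= L4_const%:E)%E.
  rewrite (eq_integral (fun x => limn (m ^~ x))); last by move=> x _; rewrite limm.
  rewrite (monotone_convergence mu mO mm m0 ndm); apply: lime_le.
    apply: ereal_nondecreasing_is_cvgn => n p np.
    apply: ge0_le_integral; [exact: mO|exact: m0|exact: mm|exact: mm|].
    by move=> x Ox; exact: ndm.
  by apply: nearW => n; apply: (truncated_L4_le _ Hfg) => //; rewrite ler1n.
have sq x : ((f * f) x) ^+ 2 = f x ^+ 4.
  by have -> : (f * f) x = f x * f x by []; ring.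
have mff : measurable_fun Omega (f * f) by exact: measurable_funM.
have L : L2 Omega (f * f).
  split => //; apply/integrableP; split.
    by apply/measurable_EFinP; exact: measurable_funX.
  apply: le_lt_trans (ltry L4_const); apply: le_trans bound.
  rewrite le_eqVlt; apply/orP; left; apply/eqP; apply: eq_integral => x _ /=.
  by rewrite sq ger0_norm// exprn_even_ge0.
split => //; rewrite -lee_fin; apply: le_trans bound.
rewrite /ip /Rintegral fineK; last exact: integrable_fin_num (L2_integrableM mO L L).
rewrite le_eqVlt; apply/orP; left; apply/eqP; apply: eq_integral => x _ /=.
by rewrite -sq expr2.
Qed.

Lemma H1_test_limit_L4 f g eps : 0 < eps -> H1_test_limit Omega f g ->
  nrm Omega f <= eps -> (forall i, nrm Omega (g i) <= eps) ->
  L2 Omega (f * f) /\ ip Omega (f * f) (f * f) <= L4_const * eps ^+ 4.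
Proof.
move=> e0 Hfg fe ge; have [Lf Lg _] := Hfg.
(* The zero pair turns the combination lemma into a scaling lemma: dividing by eps reduces to norms
   at most 1, and the fourth power of eps comes back by homogeneity. *)
have H0 : H1_test_limit Omega 0 (fun _ : 'I_d => 0).
  have := H1_test_limit_test (test0 Omega).
  rewrite (_ : (fun i => _) = (fun _ : 'I_d => 0))//.
  by apply/funext => i; apply/funext => x; rewrite /pderiv derive_cst.
have := H1_test_limit_comb eps^-1 Hfg H0; rewrite addr0.
have ei : 0 < eps^-1 by rewrite invr_gt0.
have sc h : L2 Omega h -> nrm Omega h <= eps -> nrm Omega (eps^-1 *: h + 0) <= 1.
  by move=> Lh he; rewrite addr0 nrmZ// gtr0_norm// ler_pdivrMl// mulr1.
move=> /L4_le_const[]; [by rewrite -[_ *: _]addr0; exact: sc|by move=> i; exact: sc|].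
have -> : (eps^-1 *: f) * (eps^-1 *: f) = eps^-1 ^+ 2 *: (f * f).
  apply/funext => x.
  by change (eps^-1 * f x * (eps^-1 * f x) = eps^-1 ^+ 2 * (f x * f x)); ring.
move=> LL LC; have Lff : L2 Omega (f * f).
  rewrite (_ : f * f = eps ^+ 2 *: (eps^-1 ^+ 2 *: (f * f))); first exact: L2Z.
  by rewrite scalerA -exprMn divff ?gt_eqF// expr1n scale1r.
split => //; move: LC; rewrite ipZl// ipC ipZl//.
rewrite mulrA -exprD exprVn ler_pdivrMl ?exprn_gt0//.
by rewrite [leRHS]mulrC.
Qed.

End H1_test_limit_theory.

(** * Skew-symmetry, linearity of weak derivatives, zero mean *)

Lemma linear_bound_eq0 {R : realType} (T Q : R) :
  (forall eps, 0 < eps -> eps <= 1 -> `|T| <= Q * eps) -> T = 0.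
Proof.
move=> H; apply/eqP; rewrite -normr_eq0 eq_le normr_ge0 andbT leNgt; apply/negP => T0.
have Q0 : 0 < Q by have := H 1 ltr01 (lexx _); lra.
pose eps := Num.min 1 (`|T| / (2 * Q)).
have e0 : 0 < eps by rewrite lt_min ltr01 divr_gt0// mulr_gt0.
have e1 : eps <= 1 by rewrite ge_min lexx.
have e2 : eps <= `|T| / (2 * Q) by rewrite ge_min lexx orbT.
have := H _ e0 e1.
have : Q * eps <= Q * (`|T| / (2 * Q)) by rewrite ler_pM2l.
rewrite (_ : Q * (`|T| / (2 * Q)) = `|T| / 2); last by field; rewrite gt_eqF.
lra.
Qed.

(** The expansion of the identity for psi = v - r, d psi = dv - dr: A = (uv, dv), B = (dr, uv), C =
    (dv, ur), D = (dr, ur), E = (du, v^2), F = (vr, du), G = (r^2, du). Every term on the right of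
    the conclusion contains r or dr. *)
Lemma skew_rearrange {R : realFieldType} (A B C D E F G : R) :
  A - B - (C - D) + 2^-1 * (E - (2 * F - G)) = 0 ->
  A + 2^-1 * E = B + C - D + F - 2^-1 * G.
Proof. lra. Qed.

Lemma skew_bound {R : realFieldType} (B C D F G b c d f g : R) :
  `|B| <= b -> `|C| <= c -> `|D| <= d -> `|F| <= f -> `|G| <= g ->
  `|B + C - D + F - 2^-1 * G| <= b + c + d + f + g.
Proof.
rewrite !ler_norml => /andP[? ?] /andP[? ?] /andP[? ?] /andP[? ?] /andP[? ?].
apply/andP; split; lra.
Qed.

Section H10_theory.
Context {R : realType} {d : nat} (Omega : set 'rV[R]_d).
Hypotheses (d23 : d = 2%N \/ d = 3%N) (mO : measurable Omega)
  (fO : (lebesgue_rV d Omega < +oo)%E).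
Local Notation mu := (lebesgue_rV d).
Implicit Types f g u v phi psi q : 'rV[R]_d -> R.

Lemma wderivP f i : Hm Omega 1 f ->
  L2 Omega (wderiv Omega [:: i] f) /\ is_weak_deriv Omega [:: i] f (wderiv Omega [:: i] f).
Proof.
move=> [_ /(_ [:: i] isT)[g Lg wg]].
by have := @xgetPex _ (fun=> 0) [set g | L2 Omega g /\ is_weak_deriv Omega [:: i] f g]
  (ex_intro _ g (conj Lg wg)).
Qed.

Lemma H10_test_limit f : H10 Omega f ->
  H1_test_limit Omega f (fun i => wderiv Omega [:: i] f).
Proof.
move=> [Hf appr]; split; [by case: Hf|by move=> i; case: (wderivP i Hf)|].
by move=> eps /appr[phi tphi [n m]]; exists phi.
Qed.

Lemma H10_L2 f : H10 Omega f -> L2 Omega f.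
Proof. by case=> -[]. Qed.

Lemma H10_wderiv_L2 f i : H10 Omega f -> L2 Omega (wderiv Omega [:: i] f).
Proof. by case=> /(wderivP i)[]. Qed.

Lemma H10_sqr_L2 f : H10 Omega f -> L2 Omega (f * f).
Proof.
move=> /H10_test_limit Hf.
(* Any common positive bound of the norms would do; the summand 1 ensures positivity. *)
pose c := nrm Omega f + \sum_i nrm Omega (wderiv Omega [:: i] f) + 1.
have s0 : 0 <= \sum_i nrm Omega (wderiv Omega [:: i] f) by apply: sumr_ge0 => i _; exact: nrm_ge0.
have c0 : 0 < c by have := nrm_ge0 Omega f; rewrite /c; lra.
have f0 := nrm_ge0 Omega f.
have fc : nrm Omega f <= c by rewrite /c; lra.
have gc i : nrm Omega (wderiv Omega [:: i] f) <= c.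
  have : nrm Omega (wderiv Omega [:: i] f) <= \sum_i nrm Omega (wderiv Omega [:: i] f).
    by rewrite (bigD1 i)//= lerDl; apply: sumr_ge0 => j _; exact: nrm_ge0.
  rewrite /c; lra.
by have [] := H1_test_limit_L4 d23 mO fO c0 Hf fc gc.
Qed.

Lemma L2M u v : measurable_fun Omega u -> measurable_fun Omega v ->
  L2 Omega (u * u) -> L2 Omega (v * v) -> L2 Omega (u * v).
Proof.
move=> mu' mv Lu Lv; split; first exact: measurable_funM.
have := L2_integrableM mO Lu Lv; apply: eq_integrable => // x _ /=; congr EFin.
by change (u x * u x * (v x * v x) = (u x * v x) ^+ 2); ring.
Qed.

Lemma nrmM_sqr_le u v : L2 Omega (u * u) -> L2 Omega (v * v) ->
  nrm Omega (u * v) ^+ 2 <= nrm Omega (u * u) * nrm Omega (v * v).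
Proof.
move=> Lu Lv; rewrite sqr_nrm.
have -> : ip Omega (u * v) (u * v) = ip Omega (u * u) (v * v).
  apply: eq_Rintegral => x _.
  by change (u x * v x * (u x * v x) = u x * u x * (v x * v x)); ring.
by apply: (le_trans (ler_norm _)); exact: normr_ip_le.
Qed.

Lemma weak_deriv1 f i chi : H10 Omega f -> test_function Omega chi ->
  ip Omega f (pderiv i chi) = - ip Omega (wderiv Omega [:: i] f) chi.
Proof.
by move=> [Hf _] tchi; have [_ /(_ _ tchi)] := wderivP i Hf; rewrite /= expr1 mulN1r.
Qed.

Lemma weak_deriv_sqr u i psi : H10 Omega u -> test_function Omega psi ->
  ip Omega (u * psi) (pderiv i psi) + 2^-1 * ip Omega (wderiv Omega [:: i] u) (psi * psi) = 0.
Proof.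
move=> Hu tpsi; have := weak_deriv1 i Hu (testM tpsi tpsi).
rewrite pderivM; [|by move=> x; apply: smooth_differentiable; case: tpsi..].
have Lu := H10_L2 Hu; have Lp := test_L2 mO fO (testM (test_pderiv i tpsi) tpsi).
have -> : pderiv i psi * psi + psi * pderiv i psi = 2 *: (pderiv i psi * psi).
  apply/funext => x.
  by change (pderiv i psi x * psi x + psi x * pderiv i psi x = 2 * (pderiv i psi x * psi x)); ring.
rewrite ipC ipZl// ipC.
have -> : ip Omega u (pderiv i psi * psi) = ip Omega (u * psi) (pderiv i psi).
  apply: eq_Rintegral => x _.
  by change (u x * (pderiv i psi x * psi x) = u x * psi x * pderiv i psi x); ring.
lra.
Qed.

(** The remainder r = v - psi is small in L^4 as well as in L^2, so each error term is a product of
    two L^2 norms of which at least one is of order eps. *)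
Lemma skew_identity u v i : H10 Omega u -> H10 Omega v ->
  ip Omega (u * v) (wderiv Omega [:: i] v)
  + 2^-1 * ip Omega (wderiv Omega [:: i] u) (v * v) = 0.
Proof.
move=> Hu Hv; have Lu := H10_L2 Hu; have Lv := H10_L2 Hv.
have Ldu := H10_wderiv_L2 i Hu; have Ldv := H10_wderiv_L2 i Hv.
have Luu := H10_sqr_L2 Hu; have Lvv := H10_sqr_L2 Hv.
have [mu' _] := Lu; have [mv _] := Lv.
have Luv := L2M mu' mv Luu Lvv.
have limv := H10_test_limit Hv.
have [_ _ appr] := limv.
set du := wderiv Omega [:: i] u in Ldu *; set dv := wderiv Omega [:: i] v in Ldv *.
(* K is chosen so that ||r^2|| <= K eps^2; Cauchy-Schwarz then gives ||u r|| <= cu eps and ||v r||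
   <= cv eps. *)
pose K := Num.sqrt (@L4_const R d).
have K0 : 0 <= K by exact: sqrtr_ge0.
pose cu := Num.sqrt (nrm Omega (u * u) * K); pose cv := Num.sqrt (nrm Omega (v * v) * K).
have cu0 : 0 <= cu by exact: sqrtr_ge0.
have cv0 : 0 <= cv by exact: sqrtr_ge0.
apply: (@linear_bound_eq0 _ _ (nrm Omega (u * v) + cu * nrm Omega dv + cu + cv * nrm Omega du
   + nrm Omega du * K)) => eps e0 e1.
have [psi [tpsi npsi dpsi]] := appr eps e0; have e0' := ltW e0.
have Lp := test_L2 mO fO tpsi; have Ldp := test_L2 mO fO (test_pderiv i tpsi).
(* The gradient attached to v - psi is the difference of the gradients by construction; no weak
   derivative of the difference is formed. *)
have limr : H1_test_limit Omega (v - psi) (fun j => wderiv Omega [:: j] v - pderiv j psi).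
  have := H1_test_limit_comb mO fO (-1) (H1_test_limit_test mO fO tpsi) limv.
  rewrite scaleN1r addrC (_ : (fun j => _) = (fun j => wderiv Omega [:: j] v - pderiv j psi))//.
  by apply/funext => j; rewrite scaleN1r addrC.
have [Lrr ipr] := H1_test_limit_L4 d23 mO fO e0 limr (ltW npsi) (fun j => ltW (dpsi j)).
have ndr : nrm Omega (dv - pderiv i psi) <= eps by exact: ltW (dpsi i).
have weak := weak_deriv_sqr i Hu tpsi; rewrite -/du in weak.
have [Lr Ldr _] := limr; have {}Ldr := Ldr i; rewrite -/dv in Ldr.
set r := v - psi in Lr Lrr ipr; set dr := dv - pderiv i psi in Ldr ndr.
have [mr _] := Lr.
have epsi : psi = v - r by rewrite /r opprB addrC subrK.
have edpsi : pderiv i psi = dv - dr by rewrite /dr opprB addrC subrK.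
have nrr : nrm Omega (r * r) <= K * eps ^+ 2.
  rewrite -(@ler_pXn2r _ 2) ?nnegrE ?mulr_ge0 ?nrm_ge0 ?sqr_ge0//.
  rewrite sqr_nrm exprMn sqr_sqrtr -?exprM//.
  by rewrite /L4_const; apply: addr_ge0 => //; apply: mulr_ge0 => //; exact: sqr_ge0.
have nMr (f : 'rV[R]_d -> R) : L2 Omega (f * f) ->
    nrm Omega (f * r) <= Num.sqrt (nrm Omega (f * f) * K) * eps.
  move=> Lff; rewrite -(@ler_pXn2r _ 2) ?nnegrE ?mulr_ge0 ?nrm_ge0 ?sqrtr_ge0//.
  rewrite exprMn (@sqr_sqrtr _ (nrm Omega (f * f) * K)) ?mulr_ge0 ?nrm_ge0//.
  apply: (le_trans (nrmM_sqr_le Lff Lrr)); rewrite -mulrA.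
  by apply: ler_wpM2l => //; exact: nrm_ge0.
have Lur := L2M mu' mr Luu Lrr; have Lvr := L2M mv mr Lvv Lrr.
have nur := nMr u Luu; have nvr := nMr v Lvv; rewrite -/cu -/cv in nur nvr.
clearbody r dr du dv; move: weak; rewrite edpsi epsi.
have -> : u * (v - r) = u * v - u * r by rewrite mulrBr.
have -> : (v - r) * (v - r) = v * v - (2 *: (v * r) - r * r).
  apply/funext => x.
  by change ((v x - r x) * (v x - r x) = v x * v x - (2 * (v x * r x) - r x * r x)); ring.
have Lsub := L2B mO (L2Z mO 2 Lvr) Lrr.
have Lddr := L2B mO Ldv Ldr.
rewrite ipBl//.
rewrite (ipC _ (u * v) (dv - dr)) (ipC _ (u * r) (dv - dr)) !ipBl//.
rewrite (ipC _ du) ipBl// ipBl//; last exact: L2Z.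
rewrite ipZl// (ipC _ dv (u * v)) (ipC _ (v * v) du) => weak.
have b1 := normr_ip_le mO Ldr Luv; have b2 := normr_ip_le mO Ldv Lur.
have b3 := normr_ip_le mO Ldr Lur; have b4 := normr_ip_le mO Lvr Ldu.
have b5 := normr_ip_le mO Lrr Ldu.
rewrite (skew_rearrange weak).
have nge := nrm_ge0 Omega.
have c1 : nrm Omega dr * nrm Omega (u * v) <= eps * nrm Omega (u * v) by apply: ler_wpM2r.
have c2 : nrm Omega dv * nrm Omega (u * r) <= nrm Omega dv * (cu * eps) by apply: ler_wpM2l.
(* Terms quadratic in eps are made linear by eps <= 1, here and in [c5]. *)
have c3 : nrm Omega dr * nrm Omega (u * r) <= 1 * (cu * eps).
  by apply: ler_pM => //; apply: le_trans e1.
have c4 : nrm Omega (v * r) * nrm Omega du <= cv * eps * nrm Omega du by apply: ler_wpM2r.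
have c5 : nrm Omega (r * r) * nrm Omega du <= K * eps * nrm Omega du.
  apply: ler_wpM2r => //; apply: (le_trans nrr); apply: ler_wpM2l => //.
  by rewrite expr2 ler_piMl// ltW.
apply: (le_trans (skew_bound (le_trans b1 c1) (le_trans b2 c2) (le_trans b3 c3)
  (le_trans b4 c4) (le_trans b5 c5))).
rewrite le_eqVlt; apply/orP; left; apply/eqP.
move: (nrm Omega _) (nrm Omega _) (nrm Omega _) => x y z; ring.
Qed.

(* The defect h of linearity satisfies ip h h = ip h (h - chi) for every test function chi,
   and h is an L^2 limit of such chi. *)
Lemma wderiv_comb a f1 f2 i q : H10 Omega f1 -> H10 Omega f2 ->
  H10 Omega (a *: f1 + f2) -> L2 Omega q ->
  ip Omega (wderiv Omega [:: i] (a *: f1 + f2)) q =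
  a * ip Omega (wderiv Omega [:: i] f1) q + ip Omega (wderiv Omega [:: i] f2) q.
Proof.
move=> H1 H2 H12 Lq.
have L1 := H10_wderiv_L2 i H1; have L2' := H10_wderiv_L2 i H2; have L12 := H10_wderiv_L2 i H12.
have Lf1 := H10_L2 H1; have Lf2 := H10_L2 H2.
(* The function part of this combination cancels, while entry i of its gradient part is the defect.
   Hence the defect is an L^2 limit of derivatives of test functions, which are again test
   functions. *)
have [_ Lh appr] := H1_test_limit_comb mO fO (-1)
  (H1_test_limit_comb mO fO a (H10_test_limit H1) (H10_test_limit H2)) (H10_test_limit H12).
move: (Lh i) => {}Lh.
set h : 'rV[R]_d -> R := _ + _ in Lh.
have {}appr eps : 0 < eps -> exists2 chi, test_function Omega chi & nrm Omega (h - chi) < eps.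
  move=> /appr[phi [tphi _ /(_ i) nphi]].
  by exists (pderiv i phi) => //; exact: test_pderiv.
have L12' := L2_comb mO a L1 L2'.
have hE q' : L2 Omega q' -> ip Omega h q' = ip Omega (wderiv Omega [:: i] (a *: f1 + f2)) q' -
    (a * ip Omega (wderiv Omega [:: i] f1) q' + ip Omega (wderiv Omega [:: i] f2) q').
  by move=> Lq'; rewrite /h ip_combl// ip_combl// mulN1r addrC.
clearbody h; have ort chi : test_function Omega chi -> ip Omega h chi = 0.
  move=> tchi; have Lchi := test_L2 mO fO tchi.
  rewrite (hE _ Lchi).
  have Lpchi := test_L2 mO fO (test_pderiv i tchi).
  have e12 := weak_deriv1 i H12 tchi.
  rewrite (ip_combl mO a Lf1 Lf2 Lpchi) (weak_deriv1 i H1 tchi) (weak_deriv1 i H2 tchi) in e12.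
  by rewrite -[X in X - _]opprK -e12 opprD mulrN !opprK subrr.
have hh0 : ip Omega h h = 0.
  apply: (@linear_bound_eq0 _ _ (nrm Omega h)) => eps e0 _.
  have [chi tchi nchi] := appr eps e0; have Lchi := test_L2 mO fO tchi.
  have -> : ip Omega h h = ip Omega (h - chi) h.
    by rewrite (ipBl mO Lh Lchi Lh) (ipC _ chi h) (ort _ tchi) subr0.
  apply: (le_trans (normr_ip_le mO (L2B mO Lh Lchi) Lh)); rewrite mulrC.
  by apply: ler_wpM2l; [exact: nrm_ge0|exact: ltW].
have h0 : ip Omega h q = 0.
  apply/eqP; rewrite -normr_eq0 eq_le normr_ge0 andbT.
  apply: (le_trans (normr_ip_le mO Lh Lq)).
  by rewrite /nrm hh0 sqrtr0 mul0r.
by move/eqP: h0; rewrite (hE _ Lq) subr_eq0 => /eqP.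
Qed.

(** The mean is the pairing with 1, which lies in L^2 because Omega has finite measure; it is
    therefore L^2 continuous, and it vanishes on derivatives of test functions. *)
Lemma H10_wderiv_L20 f i : H10 Omega f -> L20 Omega (wderiv Omega [:: i] f).
Proof.
move=> Hf; have L := H10_wderiv_L2 i Hf; split => //.
have L1 : L2 Omega (cst 1).
  by apply: (@L2_bounded _ _ _ mO _ 1) => // x _; rewrite normr1.
have i1 g : \int[mu]_(x in Omega) g x = ip Omega g (cst 1).
  by apply: eq_Rintegral => x _; rewrite mulr1.
apply: (@linear_bound_eq0 _ _ (nrm Omega (cst 1))) => eps e0 _.
have [_ _ /(_ _ e0)[phi [tphi _ /(_ i) nphi]]] := H10_test_limit Hf.
have Lp := test_L2 mO fO (test_pderiv i tphi).
have p0 := Rintegral_pderiv_test i tphi.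
have -> : \int[mu]_(x in Omega) wderiv Omega [:: i] f x =
    ip Omega (wderiv Omega [:: i] f - pderiv i phi) (cst 1).
  by rewrite (ipBl mO L Lp L1) -!i1 p0 subr0.
apply: (le_trans (normr_ip_le mO (L2B mO L Lp) L1)); rewrite mulrC.
by apply: ler_wpM2l; [exact: nrm_ge0|exact: ltW].
Qed.

End H10_theory.

(** * Vector fields *)

Lemma Rintegral_sum {R : realType} {dd} {T : measurableType dd}
    (mu : {measure set T -> \bar R}) (D : set T) (I : finType) (F : I -> T -> R) :
  measurable D -> (forall i, mu.-integrable D (EFin \o F i)) ->
  \int[mu]_(x in D) (\sum_i F i x) = \sum_i \int[mu]_(x in D) F i x.
Proof.
move=> mD iF; rewrite /Rintegral.
rewrite (eq_integral (fun x => \sum_i (F i x)%:E)%E); last by move=> x _; rewrite sumEFin.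
rewrite integral_sum// sum_fine// => i _.
exact: (integrable_fin_num mD (iF i)).
Qed.

Section vector_fields.
Context {R : realType} {d : nat} (Omega : set 'rV[R]_d).
Hypotheses (d23 : d = 2%N \/ d = 3%N) (mO : measurable Omega)
  (fO : (lebesgue_rV d Omega < +oo)%E).
Local Notation mu := (lebesgue_rV d).
Implicit Types (U V W : 'rV[R]_d -> 'rV[R]_d) (q : 'rV[R]_d -> R).

(** Only the products are assumed integrable: for u in L^4 and grad v in L^2, (u . grad) v is merely
    in L^(4/3), so the convective term is not covered by [vL2_mxip]. *)
Lemma mxip_row U V :
  (forall i, mu.-integrable Omega (EFin \o (fun x => U x 0 i * V x 0 i))) ->
  mxip Omega U V = \sum_i ip Omega (component U i) (component V i).
Proof.
move=> iUV; rewrite -(Rintegral_sum mO iUV).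
by apply: eq_Rintegral => x _; rewrite /mxdot big_ord1.
Qed.

Lemma vL2_mxip U V : vL2 Omega U -> vL2 Omega V ->
  mxip Omega U V = \sum_i ip Omega (component U i) (component V i).
Proof. by move=> LU LV; apply: mxip_row => i; exact: (L2_integrableM mO (LU i) (LV i)). Qed.

Lemma component_comb a U V i :
  component (a *: U + V) i = a *: component U i + component V i.
Proof. by apply/funext => x; rewrite /component !mxE. Qed.

Lemma vL2_comb a U V : vL2 Omega U -> vL2 Omega V -> vL2 Omega (a *: U + V).
Proof. by move=> LU LV i; rewrite component_comb; exact: L2_comb. Qed.

Lemma mxipC U V : mxip Omega U V = mxip Omega V U.
Proof.
apply: eq_Rintegral => x _; apply: eq_bigr => i _; apply: eq_bigr => j _.
by rewrite mulrC.
Qed.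

Lemma mxip_combl a U V W : vL2 Omega U -> vL2 Omega V -> vL2 Omega W ->
  mxip Omega (a *: U + V) W = a * mxip Omega U W + mxip Omega V W.
Proof.
move=> LU LV LW; rewrite !vL2_mxip//; last exact: vL2_comb.
rewrite mulr_sumr -big_split; apply: eq_bigr => i _ /=.
by rewrite component_comb ip_combl.
Qed.

Lemma mxipBl U V W : vL2 Omega U -> vL2 Omega V -> vL2 Omega W ->
  mxip Omega (U - V) W = mxip Omega U W - mxip Omega V W.
Proof. by move=> LU LV LW; rewrite addrC -scaleN1r mxip_combl// mulN1r addrC. Qed.

Lemma vL2B U V : vL2 Omega U -> vL2 Omega V -> vL2 Omega (U - V).
Proof. by move=> LU LV; rewrite addrC -scaleN1r; exact: vL2_comb. Qed.

Lemma mxipZl a U W : vL2 Omega U -> vL2 Omega W ->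
  mxip Omega (a *: U) W = a * mxip Omega U W.
Proof.
move=> LU LW; have -> : a *: U = (a - 1) *: U + U by rewrite scalerBl scale1r subrK.
by rewrite mxip_combl// mulrBl mul1r subrK.
Qed.

Lemma sqr_mxnrm p r (A : 'rV[R]_d -> 'M[R]_(p, r)) : mxnrm Omega A ^+ 2 = mxip Omega A A.
Proof.
rewrite sqr_sqrtr//; apply: Rintegral_ge0 => x _.
by apply: sumr_ge0 => i _; apply: sumr_ge0 => j _; rewrite -expr2 sqr_ge0.
Qed.

Lemma sqr_mxnrmB U V : vL2 Omega U -> vL2 Omega V ->
  mxnrm Omega (U - V) ^+ 2 = mxip Omega U U - 2 * mxip Omega V U + mxip Omega V V.
Proof.
move=> LU LV; have LB := vL2B LU LV.
by rewrite sqr_mxnrm mxipBl// (mxipC U) (mxipC V) !mxipBl// (mxipC U V); ring.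
Qed.

Lemma sqr_nrmB p q : L2 Omega p -> L2 Omega q ->
  nrm Omega (p - q) ^+ 2 = ip Omega p p - 2 * ip Omega q p + ip Omega q q.
Proof.
move=> Lp Lq; have LB := L2B mO Lp Lq.
by rewrite sqr_nrm ipBl// (ipC _ p) (ipC _ q) !ipBl// (ipC _ p q); ring.
Qed.

Lemma divergenceE U : divergence Omega U = \sum_i wderiv Omega [:: i] (component U i).
Proof. by apply/funext => x; rewrite fct_sumE. Qed.

Lemma L2_sum (F : 'I_d -> 'rV[R]_d -> R) : (forall i, L2 Omega (F i)) ->
  L2 Omega (\sum_i F i).
Proof.
by move=> LF; elim/big_ind: _ => [|f g Lf Lg|i _]; [exact: L2_0|exact: L2D|exact: LF].
Qed.

Lemma ip_suml (F : 'I_d -> 'rV[R]_d -> R) q : (forall i, L2 Omega (F i)) -> L2 Omega q ->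
  ip Omega (\sum_i F i) q = \sum_i ip Omega (F i) q.
Proof.
move=> LF Lq; rewrite -(Rintegral_sum mO (fun i => L2_integrableM mO (LF i) Lq)).
by apply: eq_Rintegral => x _; rewrite fct_sumE mulr_suml.
Qed.

Lemma H10_vec_vL2 U : H10_vec Omega U -> vL2 Omega U.
Proof. by move=> HU i; exact: H10_L2. Qed.

Lemma divergence_L20 U : H10_vec Omega U -> L20 Omega (divergence Omega U).
Proof.
move=> HU; have L i := H10_wderiv_L20 mO fO i (HU i).
split; first by rewrite divergenceE; apply: L2_sum => i; case: (L i).
rewrite (Rintegral_sum mO); first by apply: big1 => i _; case: (L i).
by move=> i; apply: L2_integrable => //; case: (L i).
Qed.

Lemma divergence_comb a U V q : H10_vec Omega U -> H10_vec Omega V ->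
  H10_vec Omega (a *: U + V) -> L2 Omega q ->
  ip Omega (divergence Omega (a *: U + V)) q =
  a * ip Omega (divergence Omega U) q + ip Omega (divergence Omega V) q.
Proof.
move=> HU HV HUV Lq; rewrite !divergenceE !ip_suml//; try by move=> i; exact: H10_wderiv_L2.
rewrite mulr_sumr -big_split; apply: eq_bigr => i _ /=.
rewrite component_comb; apply: wderiv_comb => //.
by rewrite -component_comb; exact: HUV.
Qed.

(** The form splits into one instance of [skew_identity] for each pair of a velocity component u_j
    and a transported component v_i. *)
Lemma bstar_skew U V : H10_vec Omega U -> H10_vec Omega V -> bstar Omega U V V = 0.
Proof.
move=> HU HV.
pose u j := component U j; pose v i := component V i.
pose du j := wderiv Omega [:: j] (u j); pose dv i j := wderiv Omega [:: j] (v i).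
have Lu j : L2 Omega (u j * u j) by apply: H10_sqr_L2 => //; exact: HU.
have Lv i : L2 Omega (v i * v i) by apply: H10_sqr_L2 => //; exact: HV.
have Luv j i : L2 Omega (u j * v i).
  by apply: L2M => //; [case: (H10_L2 (HU j))|case: (H10_L2 (HV i))].
have Ldu j : L2 Omega (du j) by exact: H10_wderiv_L2.
have Ldv i j : L2 Omega (dv i j) by exact: H10_wderiv_L2.
have iadv i j : mu.-integrable Omega (EFin \o (fun x => (u j * v i) x * dv i j x)).
  exact: L2_integrableM.
(* Regrouping as (u_j v_i) d_j v_i exhibits each term as a product of two L^2 functions. *)
have advE i x : advect Omega U V x 0 i * V x 0 i = \sum_j (u j * v i) x * dv i j x.
  rewrite mxE mulr_suml; apply: eq_bigr => j _; rewrite mxE.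
  by change (u j x * dv i j x * v i x = u j x * v i x * dv i j x); ring.
have divE i x : (divergence Omega U x *: V x) 0 i * V x 0 i = \sum_j (du j x * (v i * v i) x).
  rewrite mxE /divergence -mulrA mulr_suml; apply: eq_bigr => j _.
  by [].
have iadvs i : mu.-integrable Omega (EFin \o (fun x => advect Omega U V x 0 i * V x 0 i)).
  rewrite (_ : EFin \o _ = fun x => (\sum_j ((u j * v i) x * dv i j x)%:E)%E).
    by apply: integrable_sum => // j _; exact: iadv.
  by apply/funext => x /=; rewrite advE sumEFin.
have idu i j : mu.-integrable Omega (EFin \o (fun x => du j x * (v i * v i) x)).
  exact: L2_integrableM.
have idivs i : mu.-integrable Omega
    (EFin \o (fun x => (divergence Omega U x *: V x) 0 i * V x 0 i)).
  rewrite (_ : EFin \o _ = fun x => (\sum_j (du j x * (v i * v i) x)%:E)%E).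
    by apply: integrable_sum => // j _; exact: idu.
  by apply/funext => x /=; rewrite divE sumEFin.
rewrite /bstar !mxip_row// mulr_sumr -big_split; apply: big1 => i _ /=.
have -> : ip Omega (component (advect Omega U V) i) (component V i) =
    \sum_j ip Omega (u j * v i) (dv i j).
  rewrite -(Rintegral_sum mO (iadv i)); apply: eq_Rintegral => x _; exact: advE.
have -> : ip Omega (component (fun x => divergence Omega U x *: V x) i) (component V i) =
    \sum_j ip Omega (du j) (v i * v i).
  rewrite -(Rintegral_sum mO (idu i)); apply: eq_Rintegral => x _; exact: divE.
rewrite mulr_sumr -big_split; apply: big1 => j _ /=.
exact: skew_identity.
Qed.

End vector_fields.

(** * The energy identity *)

(** Indices 1 and 0 stand for times n+1 and n. W and P are inner products of the velocities and of
    the modified pressures p, G = ||grad w||^2, L = (lambda, div w), N = ||Pi_Q div w||^2, all three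
    at time n+1, and a2 = alpha^2. The coupling L is eliminated between the two tested equations;
    the cross terms W01 and P01 then cancel against the expanded squares. *)
Lemma energy_step_algebra {R : realFieldType}
    (k nu beta a2 W11 W01 W00 G L Fv P11 P01 P00 N : R) :
  k != 0 -> a2 != 0 ->
  k^-1 * (W11 - W01) + nu * G - L = Fv ->
  k^-1 * (P11 - P01) + a2 * (L + 2 * beta * N) = 0 ->
  2^-1 * W11 + a2^-1 / 2 * P11 + k * (2 * beta * N + nu * G)
  + 2^-1 * (a2^-1 * (P11 - 2 * P01 + P00) + (W11 - 2 * W01 + W00)) =
  2^-1 * W00 + a2^-1 / 2 * P00 + k * Fv.
Proof.
move=> k0 a0 <- H.
have -> : L = - (k * a2)^-1 * (P11 - P01) - 2 * beta * N.
  have e : L + 2 * beta * N = - (a2^-1 * (k^-1 * (P11 - P01))).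
    apply: (mulfI a0); rewrite mulrN mulVKf//.
    by move/eqP: H; rewrite addrC addr_eq0 => /eqP.
  by rewrite -[LHS](addrK (2 * beta * N)) e; field; rewrite k0 a0.
by field; rewrite k0 a0.
Qed.

Unset Implicit Arguments.
Set Strict Implicit.
Set Printing Implicit Defensive.

Theorem theorem4p3 (R : realType) (d : nat) (hd : d = 2%N \/ d = 3%N)
    (Omega : set 'rV[R]_d) (hOmega : regular_bounded_domain Omega)
    (m : nat) (meshes : set R)
    (Xh : R -> set ('rV[R]_d -> 'rV[R]_d)) (Qh : R -> set ('rV[R]_d -> R))
    (hfe : conforming_fe_family Omega m meshes Xh Qh)
    (h : R) (hh : meshes h)
    (PiQ : ('rV[R]_d -> R) -> 'rV[R]_d -> R)
    (hPiQ : is_L2_projection Omega (Qh h) PiQ)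
    (k nu beta alpha : R)
    (hk : 0 < k) (hnu : 0 < nu) (hbeta : 0 < beta) (halpha : 0 < alpha ^+ 2)
    (f : 'rV[R]_d -> R -> 'rV[R]_d)
    (hf : forall n : nat, vL2 Omega (fun x => f x (n.+1%:R * k)))
    (w : nat -> 'rV[R]_d -> 'rV[R]_d) (lambda : nat -> 'rV[R]_d -> R)
    (hw : forall n, Xh h (w n)) (hlambda : forall n, Qh h (lambda n))
    (momentum : forall (n : nat) v, Xh h v ->
      mxip Omega (k^-1 *: (w n.+1 - w n)) v
      + bstar Omega (w n) (w n.+1) v
      + nu * mxip Omega (grad Omega (w n.+1)) (grad Omega v)
      - ip Omega (lambda n.+1) (divergence Omega v)
      = mxip Omega (fun x => f x (n.+1%:R * k)) v)
    (continuity : forall (n : nat) q, Qh h q ->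
      ip Omega (k^-1 *: (lambda n.+1 - lambda n)) q
      + 2 * beta * ip Omega (divergence Omega (k^-1 *: (w n.+1 - w n))) q
      + alpha ^+ 2 * ip Omega (divergence Omega (w n.+1)) q = 0) :
  forall N : nat, (1 <= N)%N ->
    2^-1 * mxnrm Omega (w N) ^+ 2
    + alpha ^- 2 / 2
      * nrm Omega (lambda N + (2 * beta) *: PiQ (divergence Omega (w N))) ^+ 2
    + k * \sum_(0 <= n < N)
        (2 * beta * nrm Omega (PiQ (divergence Omega (w n.+1))) ^+ 2
         + nu * mxnrm Omega (grad Omega (w n.+1)) ^+ 2)
    + \sum_(0 <= n < N) 2^-1 *
        (alpha ^- 2 * nrm Omega
           (lambda n.+1 + (2 * beta) *: PiQ (divergence Omega (w n.+1))
            - lambda n - (2 * beta) *: PiQ (divergence Omega (w n))) ^+ 2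
         + mxnrm Omega (w n.+1 - w n) ^+ 2)
    = 2^-1 * mxnrm Omega (w 0%N) ^+ 2
    + alpha ^- 2 / 2
      * nrm Omega (lambda 0%N + (2 * beta) *: PiQ (divergence Omega (w 0%N))) ^+ 2
    + k * \sum_(0 <= n < N) mxip Omega (fun x => f x (n.+1%:R * k)) (w n.+1).
Proof.
have [_ oO _ bO _] := hOmega.
have mO : measurable Omega := open_measurable_rV oO.
have fO : (lebesgue_rV d Omega < +oo)%E := bounded_lebesgue_rV_fin mO bO.
have [/(_ h hh)[h0 XH [X0 Xlin _] QL [Q0 Qlin _]] _ _ _] := hfe.
have Hw n : H10_vec Omega (w n) := XH _ (hw n).
have Lw n : vL2 Omega (w n) := H10_vec_vL2 (Hw n).
have QL2 q : Qh h q -> L2 Omega q by move=> /QL[].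
have Ll n : L2 Omega (lambda n) := QL2 _ (hlambda n).
pose D n := divergence Omega (w n).
have D20 n : L20 Omega (D n) := divergence_L20 mO fO (Hw n).
have LD n : L2 Omega (D n) := (D20 n).1.
have QP n : Qh h (PiQ (D n)) := (hPiQ _ (D20 n)).1.
have LP n : L2 Omega (PiQ (D n)) := QL2 _ (QP n).
have proj n q : Qh h q -> ip Omega (PiQ (D n)) q = ip Omega (D n) q.
  move=> Qq; have := (hPiQ _ (D20 n)).2 q Qq.
  by rewrite (ipBl mO (LD n) (LP n) (QL2 _ Qq)) => /eqP; rewrite subr_eq0 => /eqP.
pose p n := lambda n + (2 * beta) *: PiQ (D n).
have Qp n : Qh h (p n) by rewrite /p addrC; exact: Qlin.
have Lp n : L2 Omega (p n) := QL2 _ (Qp n).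
have ipp n q : L2 Omega q ->
    ip Omega (p n) q = ip Omega (lambda n) q + 2 * beta * ip Omega (PiQ (D n)) q.
  by move=> Lq; rewrite /p addrC ip_combl// addrC.
have k0 : k != 0 by rewrite gt_eqF.
have a0 : alpha ^+ 2 != 0 by rewrite gt_eqF.
have vL2_0 : vL2 Omega 0.
  by move=> i; rewrite (_ : component 0 i = 0);
    [exact: L2_0|apply/funext => x; rewrite /component mxE].
pose incr n := k^-1 *: (w n.+1 - w n).
(* The divergence is linear only on H^1_0 fields, so the increment is written as a combination
   within X^h. *)
have incrE n : incr n = k^-1 *: w n.+1 + (- k^-1) *: w n.
  by rewrite /incr scalerBr scaleNr.
have Xw c n : Xh h (c *: w n) by rewrite -[_ *: _]addr0; exact: Xlin.
have XXw a n c n' : Xh h (a *: w n + c *: w n') by apply: Xlin.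
have divZ c n q : L2 Omega q ->
    ip Omega (divergence Omega (c *: w n)) q = c * ip Omega (D n) q.
  (* Writing c w as (c - 1) w + w obtains homogeneity from the combination rule without treating the
     zero field. *)
  move=> Lq; have := divergence_comb mO fO (a := c - 1) (Hw n) (Hw n) _ Lq.
  rewrite (_ : (c - 1) *: w n + w n = c *: w n); last by rewrite scalerBl scale1r subrK.
  by move=> ->; [rewrite /D mulrBl mul1r subrK|exact: XH].
have divincr n q : L2 Omega q -> ip Omega (divergence Omega (incr n)) q =
    k^-1 * (ip Omega (D n.+1) q - ip Omega (D n) q).
  move=> Lq; rewrite incrE.
  rewrite (divergence_comb mO fO (Hw n.+1) (XH _ (Xw (- k^-1) n)) (XH _ (XXw _ _ _ _)) Lq).
  by rewrite (divZ _ _ _ Lq) mulNr mulrBr.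
have pE n : p n = lambda n + (2 * beta) *: PiQ (D n) by [].
have DE n : divergence Omega (w n) = D n by [].
clearbody p D.
have step n :
    2^-1 * mxnrm Omega (w n.+1) ^+ 2 + alpha ^- 2 / 2 * nrm Omega (p n.+1) ^+ 2
    + k * (2 * beta * nrm Omega (PiQ (D n.+1)) ^+ 2
           + nu * mxnrm Omega (grad Omega (w n.+1)) ^+ 2)
    + 2^-1 * (alpha ^- 2 * nrm Omega (p n.+1 - p n) ^+ 2
              + mxnrm Omega (w n.+1 - w n) ^+ 2)
    = 2^-1 * mxnrm Omega (w n) ^+ 2 + alpha ^- 2 / 2 * nrm Omega (p n) ^+ 2
    + k * mxip Omega (fun x => f x (n.+1%:R * k)) (w n.+1).
  rewrite (sqr_mxnrmB mO (Lw n.+1) (Lw n)) (sqr_nrmB mO (Lp n.+1) (Lp n)).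
  rewrite (@sqr_mxnrm R d Omega _ _ (w n.+1)) (@sqr_mxnrm R d Omega _ _ (w n)).
  rewrite (@sqr_mxnrm R d Omega _ _ (grad Omega (w n.+1))).
  rewrite (@sqr_nrm R d Omega (p n.+1)) (@sqr_nrm R d Omega (p n)).
  rewrite (@sqr_nrm R d Omega (PiQ (D n.+1))).
  apply: (@energy_step_algebra R k nu beta (alpha ^+ 2) (mxip Omega (w n.+1) (w n.+1))
    (mxip Omega (w n) (w n.+1)) (mxip Omega (w n) (w n))
    (mxip Omega (grad Omega (w n.+1)) (grad Omega (w n.+1)))
    (ip Omega (lambda n.+1) (D n.+1)) (mxip Omega (fun x => f x (n.+1%:R * k)) (w n.+1))
    (ip Omega (p n.+1) (p n.+1)) (ip Omega (p n) (p n.+1)) (ip Omega (p n) (p n))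
    (ip Omega (PiQ (D n.+1)) (PiQ (D n.+1))) k0 a0).
    have := momentum n _ (hw n.+1).
    rewrite (bstar_skew hd mO fO (Hw n) (Hw n.+1)) addr0.
    by rewrite DE (mxipZl mO _ (vL2B mO (Lw n.+1) (Lw n)) (Lw n.+1)) mxipBl.
  have := continuity n _ (Qp n.+1).
  rewrite -/(incr n) (divincr _ _ (Lp n.+1)) DE (ipZl mO _ (L2B mO (Ll n.+1) (Ll n)) (Lp n.+1)).
  rewrite (ipBl mO (Ll n.+1) (Ll n) (Lp n.+1)).
  rewrite -(proj n.+1 _ (Qp n.+1)) -(proj n _ (Qp n.+1)).
  (* Since lambda and Pi_Q (div w) lie in Q^h, testing the divergence with p yields exactly the
     pressure term of the momentum equation plus the dissipation 2 beta ||Pi_Q div w||^2. *)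
  have e : ip Omega (PiQ (D n.+1)) (p n.+1) = ip Omega (lambda n.+1) (D n.+1)
      + 2 * beta * ip Omega (PiQ (D n.+1)) (PiQ (D n.+1)).
    rewrite (proj _ _ (Qp n.+1)) ipC (ipp _ _ (LD n.+1)).
    by rewrite (proj _ _ (QP n.+1)) (ipC Omega (D n.+1)).
  (* The increments of lambda and of 2 beta Pi_Q (div w) add up to the increment of p. *)
  rewrite (ipp n.+1 _ (Lp n.+1)) (ipp n _ (Lp n.+1)) -e => H.
  by rewrite -[RHS]H; ring.
(* At N = 0 both sides are the initial energy; each further index adds one instance of [step]. *)
move=> N _; elim: N => [|N IH]; first by rewrite !big_nil mulr0 !addr0.
rewrite !big_nat_recr//= !DE -!pE in IH *.
have -> : p N.+1 - lambda N - (2 * beta) *: PiQ (D N) = p N.+1 - p N.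
  by rewrite (pE N) opprD addrA.
by have := step N; move: IH; lra.
Qed.
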